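(* Let $\pi:\mathcal{E}\to\mathcal{B}$ be a bifibration over a finitely complete category $\mathcal{B}$, satisfying the Beck--Chevalley condition, and equipped with a section $\iota:\mathcal{B}\to\mathcal{E}$ preserved by pullback. Then the data of decorated spans in $\mathcal{B}$ with copy-composition of sections (objects, vertical 1-cells, horizontal 1-cells, 2-cells, pull-push horizontal composition and horizontal units, as listed in the context) define a pseudo double category $\mathbb{S}$ which is doubly fibred over $\mathbb{S}\mathbf{pan}(\mathcal{B})_{pb}$, via the projection that forgets the sections.
   Context: Double categories are pseudo double categories, with strict composition in the vertical category and weak composition in the horizontal direction. Setting. $\mathcal{E}_B$ is the fibre of $\pi$ over $B$. For $f:A\to B$ in $\mathcal{B}$, $\Delta_f:\mathcal{E}_B\to\mathcal{E}_A$ is the reindexing (pullback) functor and $\Sigma_f:\mathcal{E}_A\to\mathcal{E}_B$ its left adjoint. Beck--Chevalley: for every pullback square in $\mathcal{B}$ with $p:E\to B$, $q:F\to B$ and projections $\pi_E:Q\to E$, $\pi_F:Q\to F$, the canonical transformation $\Sigma_{\pi_F}\Delta_{\pi_E}\to\Delta_q\Sigma_p$ is an isomorphism. A section is a functor $\iota:\mathcal{B}\to\mathcal{E}$ with $\pi\circ\iota=\mathrm{id}_{\mathcal{B}}$. That it is preserved by pullback means $\Delta_f\,\iota B=\iota A$ for every $f:A\to B$ (canonical isomorphisms such as these being treated as identifications). Base. $\mathbb{S}\mathbf{pan}(\mathcal{B})$ is the double category with objects and vertical 1-cells those of $\mathcal{B}$, horizontal 1-cells spans in $\mathcal{B}$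 (composed by pullback), and 2-cells morphisms of spans. $\mathbb{S}\mathbf{pan}(\mathcal{B})_{pb}$ is its sub-double category whose 2-cells are the Cartesian morphisms of spans: a 2-cell $(f_l,f,f_r)$ from $(A\xleftarrow{a}E\xrightarrow{b}B)$ to $(A'\xleftarrow{a'}E'\xrightarrow{b'}B')$ consists of $f_l:A\to A'$, $f:E\to E'$, $f_r:B\to B'$ with $a'f=f_la$ and $b'f=f_rb$ such that both of these squares are pullbacks. The data of $\mathbb{S}$: (1) Objects are the objects of $\mathcal{B}$; vertical 1-cells and their composition are as in $\mathcal{B}$. (2) A horizontal 1-cell $A\nrightarrow B$ is a quadruple $(E,a,b,\sigma)$ where $(A\xleftarrow{a}E\xrightarrow{b}B)$ is a span in $\mathcal{B}$ and $\sigma\in\mathcal{E}_A(\iota A,\Sigma_a\,\iota E)$. (3) A 2-cell from $(E,a,b,\sigma)$ to $(E',a',b',\sigma')$ is a Cartesian morphism of spans $(f_l,f,f_r)$ such that $\sigma=\Delta_{f_l}\sigma'$, where $\Delta_{f_l}\sigma':\Delta_{f_l}\iota A'\to\Delta_{f_l}\Sigma_{a'}\iota E'$ is regarded as a morphism $\iota A\to\Sigma_a\,\iota E$ via $\Delta_{f_l}\iota A'=\iota A$ and $\Delta_{f_l}\Sigma_{a'}\iota E'\cong\Sigma_a\Delta_f\iota E'=\Sigma_a\iota E$ (Beck--Chevalley). (4) Horizontal composition is by pullback on spans and their morphisms, and by pull-push on sections: for $m=(A\xleftarrow{a}E\xrightarrow{b}B)$ with section $\sigma$ and $n=(B\xleftarrow{b'}F\xrightarrow{c}C)$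 with section $\tau\in\mathcal{E}_B(\iota B,\Sigma_{b'}\iota F)$, the composite section is $\Sigma_a\Delta_b(\tau)\circ\sigma$, regarded as a morphism $\iota A\to\Sigma_{a\circ\pi_E}\,\iota(E\times_BF)$ via $\Delta_b\Sigma_{b'}\iota F\cong\Sigma_{\pi_E}\Delta_{\pi_F}\iota F=\Sigma_{\pi_E}\iota(E\times_BF)$, with $\pi_E,\pi_F$ the projections from $E\times_BF$. (5) The horizontal unit on an object $E$ is the identity span $E=E=E$ with section $\mathrm{id}_{\iota E}$. Equivalently, $\mathbb{S}$ is the double Grothendieck construction of the indexed double category on $\mathbb{S}\mathbf{pan}(\mathcal{B})_{pb}$ (vertically opposed) that is constant at the terminal category on objects and sends a span $(A\xleftarrow{a}E\xrightarrow{b}B)$ to the set $\mathcal{E}_A(\iota A,\Sigma_a\iota E)$. A pseudo double category $\mathbb{S}$ is doubly fibred over $\mathbb{D}$ if there is a double fibration $\Pi:\mathbb{S}\to\mathbb{D}$: a strict double functor whose component $\Pi_0$ on vertical categories (objects and vertical 1-cells) and component $\Pi_1$ on the categories of horizontal 1-cells and 2-cells are Grothendieck fibrations, admitting cleavages preserved by the source and target functors, and such that the horizontal composition and horizontal unit functors preserve Cartesian morphisms. *)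

(* Defs.v *)
From Stdlib Require Import ssreflect List IndefiniteDescription ProofIrrelevance.

Set Implicit Arguments.
Unset Strict Implicit.
Unset Printing Implicit Defensive.

Definition the (A : Type) (P : A -> Prop) (h : exists! x, P x) : A :=
  proj1_sig (constructive_indefinite_description (unique P) h).

Lemma theP (A : Type) (P : A -> Prop) (h : exists! x, P x) : P (the h).
Proof.
by rewrite /the; case: constructive_indefinite_description => x [].
Qed.

Lemma the_eq (A : Type) (P : A -> Prop) (h : exists! x, P x) x :
  P x -> x = the h.
Proof.
move=> Px; rewrite /the; case: constructive_indefinite_description => y [_ hy] /=.
by symmetry; apply: hy.
Qed.

(** * Categories and functors *)

Record Category := MkCategory {
  Ob :> Type;
  Hom : Ob -> Ob -> Type;
  idm : forall A, Hom A A;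
  comp : forall A B C, Hom B C -> Hom A B -> Hom A C;
  comp_idl : forall A B (f : Hom A B), comp (idm B) f = f;
  comp_idr : forall A B (f : Hom A B), comp f (idm A) = f;
  comp_assoc : forall A B C D (h : Hom C D) (g : Hom B C) (f : Hom A B),
    comp h (comp g f) = comp (comp h g) f }.

Notation "g ∘ f" := (comp g f) (at level 40, left associativity).

Record Functor (C D : Category) := MkFunctor {
  fun_ob :> C -> D;
  fun_mor : forall A B : C, Hom A B -> Hom (fun_ob A) (fun_ob B);
  fun_id : forall A : C, fun_mor (idm A) = idm (fun_ob A);
  fun_comp : forall (X Y Z : C) (g : Hom Y Z) (f : Hom X Y),
    fun_mor (g ∘ f) = fun_mor g ∘ fun_mor f }.

Definition id_functor (C : Category) : Functor C C :=
  @MkFunctor C C (fun A => A) (fun _ _ f => f)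
    (fun _ => eq_refl) (fun _ _ _ _ _ => eq_refl).

Definition is_iso (C : Category) (A B : C) (f : Hom A B) : Prop :=
  exists g : Hom B A, g ∘ f = idm A /\ f ∘ g = idm B.

Definition inv (C : Category) (A B : C) (f : Hom A B) (h : is_iso f) : Hom B A :=
  proj1_sig (constructive_indefinite_description _ h).

(* The identity morphism, typed along an equality of objects. *)
Definition eq_hom (C : Category) (A B : C) (e : A = B) : Hom A B :=
  match e in _ = B' return Hom A B' with eq_refl => idm A end.

(** * Finite limits *)

Record cone (J C : Category) (D : Functor J C) (c : C) := MkCone {
  leg : forall j : J, Hom c (D j);
  leg_nat : forall (i j : J) (f : Hom i j), fun_mor D f ∘ leg i = leg j }.

Definition is_limit (J C : Category) (D : Functor J C) (c : C) (k : cone D c) : Prop :=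
  forall (c' : C) (k' : cone D c'),
  exists! u : Hom c' c, forall j, leg k j ∘ u = leg k' j.

Definition finite_type (A : Type) : Prop := exists l : list A, forall x, In x l.

Definition finite_category (J : Category) : Prop :=
  finite_type J /\ forall i j : J, finite_type (Hom i j).

Definition finitely_complete (C : Category) : Prop :=
  forall J : Category, finite_category J -> forall D : Functor J C,
  exists (c : C) (k : cone D c), is_limit k.

Definition is_pullback (C : Category) (E F B Q : C) (p : Hom E B) (q : Hom F B)
    (pE : Hom Q E) (pF : Hom Q F) : Prop :=
  p ∘ pE = q ∘ pF /\
  forall (X : C) (x : Hom X E) (y : Hom X F), p ∘ x = q ∘ y ->
  exists! u : Hom X Q, pE ∘ u = x /\ pF ∘ u = y.

Record pullback (C : Category) (E F B : C) (p : Hom E B) (q : Hom F B) := MkPullback {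
  pb_ob : C;
  pb_fst : Hom pb_ob E;
  pb_snd : Hom pb_ob F;
  pb_is : is_pullback p q pb_fst pb_snd }.

Definition chosen_pullbacks (C : Category) : Type :=
  forall (E F B : C) (p : Hom E B) (q : Hom F B), pullback p q.

Definition pb_med (C : Category) (E F B : C) (p : Hom E B) (q : Hom F B)
    (P : pullback p q) (X : C) (x : Hom X E) (y : Hom X F) (e : p ∘ x = q ∘ y) :
    Hom X (pb_ob P) :=
  the (proj2 (pb_is P) X x y e).

Section PullbackLemmas.
Context (C : Category) (E F B : C) (p : Hom E B) (q : Hom F B) (P : pullback p q).

Lemma pb_comm : p ∘ pb_fst P = q ∘ pb_snd P.
Proof. exact: (proj1 (pb_is P)). Qed.

Lemma pb_med_fst X (x : Hom X E) (y : Hom X F) e : pb_fst P ∘ pb_med P (x:=x) (y:=y) e = x.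
Proof. exact: (proj1 (theP (proj2 (pb_is P) X x y e))). Qed.

Lemma pb_med_snd X (x : Hom X E) (y : Hom X F) e : pb_snd P ∘ pb_med P (x:=x) (y:=y) e = y.
Proof. exact: (proj2 (theP (proj2 (pb_is P) X x y e))). Qed.

Lemma pb_ext X (u v : Hom X (pb_ob P)) :
  pb_fst P ∘ u = pb_fst P ∘ v -> pb_snd P ∘ u = pb_snd P ∘ v -> u = v.
Proof.
move=> e1 e2.
have e : p ∘ (pb_fst P ∘ v) = q ∘ (pb_snd P ∘ v) by rewrite !comp_assoc pb_comm.
rewrite (the_eq (proj2 (pb_is P) X _ _ e) (conj e1 e2)).
by symmetry; apply: the_eq.
Qed.
End PullbackLemmas.

(** * Fibrations, opfibrations and reindexing *)

Definition is_cartesian (E B : Category) (pi : Functor E B) (X Y : E) (g : Hom X Y) : Prop :=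
  forall (Z : E) (h : Hom Z Y) (k : Hom (pi Z) (pi X)),
  fun_mor pi h = fun_mor pi g ∘ k ->
  exists! l : Hom Z X, fun_mor pi l = k /\ g ∘ l = h.

Definition is_opcartesian (E B : Category) (pi : Functor E B) (X Y : E) (g : Hom X Y) : Prop :=
  forall (Z : E) (h : Hom X Z) (k : Hom (pi Y) (pi Z)),
  fun_mor pi h = k ∘ fun_mor pi g ->
  exists! l : Hom Y Z, fun_mor pi l = k /\ l ∘ g = h.

Section Fibres.
Context (E B : Category) (pi : Functor E B).

Record fob (b : B) := Fob { fobj :> E; fob_eq : pi fobj = b }.

Definition over (a b : B) (f : Hom a b) (X : fob a) (Y : fob b) (g : Hom X Y) : Prop :=
  eq_hom (fob_eq Y) ∘ fun_mor pi g = f ∘ eq_hom (fob_eq X).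

Record fhom (a b : B) (f : Hom a b) (X : fob a) (Y : fob b) := Fhom {
  fmor :> Hom X Y;
  fmor_over : over f fmor }.

Lemma fhom_eq (a b : B) (f : Hom a b) (X : fob a) (Y : fob b) (g h : fhom f X Y) :
  fmor g = fmor h -> g = h.
Proof.
case: g h => [g og] [h oh] /= e; subst h; congr Fhom; exact: proof_irrelevance.
Qed.

Lemma over_id (b : B) (X : fob b) : over (idm b) (idm X).
Proof. by rewrite /over fun_id comp_idl comp_idr. Qed.

Lemma over_comp (a b c : B) (f : Hom a b) (g : Hom b c) (h : Hom a c)
    (X : fob a) (Y : fob b) (Z : fob c) (v : Hom Y Z) (u : Hom X Y) :
  g ∘ f = h -> over g v -> over f u -> over h (v ∘ u).
Proof.
rewrite /over => <- ov ou.
by rewrite fun_comp comp_assoc ov -comp_assoc ou comp_assoc.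
Qed.

Definition fcomp (a b c : B) (f : Hom a b) (g : Hom b c)
    (X : fob a) (Y : fob b) (Z : fob c) (v : fhom g Y Z) (u : fhom f X Y) :
    fhom (g ∘ f) X Z :=
  Fhom (over_comp eq_refl (fmor_over v) (fmor_over u)).

Definition Fib_id (b : B) (X : fob b) : fhom (idm b) X X := Fhom (over_id X).

Definition Fib_comp (b : B) (X Y Z : fob b)
    (v : fhom (idm b) Y Z) (u : fhom (idm b) X Y) : fhom (idm b) X Z :=
  Fhom (over_comp (comp_idl (idm b)) (fmor_over v) (fmor_over u)).

(* The fibre E_b. *)
Definition Fib (b : B) : Category.
Proof.
refine (@MkCategory (fob b) (fhom (idm b)) (@Fib_id b) (@Fib_comp b) _ _ _).
- by move=> X Y f; apply: fhom_eq; rewrite /= comp_idl.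
- by move=> X Y f; apply: fhom_eq; rewrite /= comp_idr.
- by move=> X Y Z W h g f; apply: fhom_eq; rewrite /= comp_assoc.
Defined.

Record cart_lift (a b : B) (f : Hom a b) (Y : fob b) := MkCartLift {
  cl_dom : fob a;
  cl_mor : fhom f cl_dom Y;
  cl_cart : is_cartesian pi cl_mor }.

Record opcart_lift (a b : B) (f : Hom a b) (X : fob a) := MkOpcartLift {
  ol_cod : fob b;
  ol_mor : fhom f X ol_cod;
  ol_opcart : is_opcartesian pi ol_mor }.

Arguments cl_cart {a b f Y} _.
Arguments ol_opcart {a b f X} _.

Definition cleavage : Type := forall (a b : B) (f : Hom a b) (Y : fob b), cart_lift f Y.

Definition opcleavage : Type := forall (a b : B) (f : Hom a b) (X : fob a), opcart_lift f X.

Lemma cart_exists (a b c : B) (f : Hom b c) (X : fob b) (Y : fob c) (g : fhom f X Y)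
    (hg : is_cartesian pi g) (Z : fob a) (h' : Hom a c) (h : fhom h' Z Y) (k : Hom a b)
    (e : f ∘ k = h') :
  exists! l : fhom k Z X, g ∘ l = h :> Hom Z Y.
Proof.
case: X Y Z g hg h => [X pX] [Y pY] [Z pZ] [g og] /= hg [h oh] /=.
subst a b c h'; rewrite /over /= comp_idl comp_idr in og oh; subst f.
rewrite comp_idl comp_idr in oh.
have [l [[ol el] ul]] := hg Z h k oh.
have ol' : @over (pi Z) (pi X) k (@Fob (pi Z) Z eq_refl) (@Fob (pi X) X eq_refl) l.
  by rewrite /over /= comp_idl comp_idr.
exists (Fhom ol'); split=> //= -[l2 ol2] /= el2.
apply: fhom_eq => /=; apply: ul; split=> //.
by rewrite /over /= comp_idl comp_idr in ol2.
Qed.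

Lemma opcart_exists (a b c : B) (f : Hom a b) (X : fob a) (Y : fob b) (g : fhom f X Y)
    (hg : is_opcartesian pi g) (Z : fob c) (h' : Hom a c) (h : fhom h' X Z) (k : Hom b c)
    (e : k ∘ f = h') :
  exists! l : fhom k Y Z, l ∘ g = h :> Hom X Z.
Proof.
case: X Y Z g hg h => [X pX] [Y pY] [Z pZ] [g og] /= hg [h oh] /=.
subst a b c h'; rewrite /over /= comp_idl comp_idr in og oh; subst f.
rewrite comp_idl comp_idr in oh.
have [l [[ol el] ul]] := hg Z h k oh.
have ol' : @over (pi Y) (pi Z) k (@Fob (pi Y) Y eq_refl) (@Fob (pi Z) Z eq_refl) l.
  by rewrite /over /= comp_idl comp_idr.
exists (Fhom ol'); split=> //= -[l2 ol2] /= el2.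
apply: fhom_eq => /=; apply: ul; split=> //.
by rewrite /over /= comp_idl comp_idr in ol2.
Qed.

(* The factorization of h through a Cartesian g, respectively an opCartesian g. *)
Definition cart_fill (a b c : B) (f : Hom b c) (X : fob b) (Y : fob c) (g : fhom f X Y)
    (hg : is_cartesian pi g) (Z : fob a) (h' : Hom a c) (h : fhom h' Z Y) (k : Hom a b)
    (e : f ∘ k = h') : fhom k Z X :=
  the (cart_exists hg h e).

Definition opcart_fill (a b c : B) (f : Hom a b) (X : fob a) (Y : fob b) (g : fhom f X Y)
    (hg : is_opcartesian pi g) (Z : fob c) (h' : Hom a c) (h : fhom h' X Z) (k : Hom b c)
    (e : k ∘ f = h') : fhom k Y Z :=
  the (opcart_exists hg h e).

Lemma id_swap (a b : B) (f : Hom a b) : f ∘ idm a = idm b ∘ f.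
Proof. by rewrite comp_idl comp_idr. Qed.

Section Reindexing.
Context (cl : cleavage) (a b : B) (f : Hom a b).

Definition Delta_mor (Y Y' : Fib b) (u : Hom Y Y') :
    @Hom (Fib a) (cl_dom (cl f Y)) (cl_dom (cl f Y')) :=
  cart_fill (cl_cart (cl f Y')) (fcomp u (cl_mor (cl f Y))) (id_swap f).

Lemma Delta_morP (Y Y' : Fib b) (u : Hom Y Y') :
  cl_mor (cl f Y') ∘ fmor (Delta_mor u) = fmor u ∘ cl_mor (cl f Y).
Proof. exact: (theP (cart_exists _ _ _)). Qed.

Lemma Delta_mor_eq (Y Y' : Fib b) (u : Hom Y Y') (v : Hom (cl_dom (cl f Y)) (cl_dom (cl f Y')))
    (ov : over (idm a) v) :
  cl_mor (cl f Y') ∘ v = fmor u ∘ cl_mor (cl f Y) -> Delta_mor u = Fhom ov.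
Proof. by move=> e; symmetry; apply: (the_eq (cart_exists _ _ _)). Qed.

Definition Delta : Functor (Fib b) (Fib a).
Proof.
refine (@MkFunctor (Fib b) (Fib a) (fun Y => cl_dom (cl f Y)) Delta_mor _ _).
- by move=> Y; apply: Delta_mor_eq; rewrite /= comp_idl comp_idr.
- move=> X Y Z v u; apply: Delta_mor_eq => /=.
  by rewrite comp_assoc Delta_morP -!comp_assoc Delta_morP.
Defined.
End Reindexing.

(* Sigma_f is given by opCartesian lifts of f; its adjointness to Delta_f is the
   bijection of both hom-sets with the morphisms lying over f. *)
Section Pushing.
Context (ocl : opcleavage) (a b : B) (f : Hom a b).

Definition Sigma_mor (X X' : Fib a) (u : Hom X X') :
    @Hom (Fib b) (ol_cod (ocl f X)) (ol_cod (ocl f X')) :=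
  opcart_fill (ol_opcart (ocl f X)) (fcomp (ol_mor (ocl f X')) u) (eq_sym (id_swap f)).

Lemma Sigma_morP (X X' : Fib a) (u : Hom X X') :
  fmor (Sigma_mor u) ∘ ol_mor (ocl f X) = ol_mor (ocl f X') ∘ fmor u.
Proof. exact: (theP (opcart_exists _ _ _)). Qed.

Lemma Sigma_mor_eq (X X' : Fib a) (u : Hom X X') (v : Hom (ol_cod (ocl f X)) (ol_cod (ocl f X')))
    (ov : over (idm b) v) :
  v ∘ ol_mor (ocl f X) = ol_mor (ocl f X') ∘ fmor u -> Sigma_mor u = Fhom ov.
Proof. by move=> e; symmetry; apply: (the_eq (opcart_exists _ _ _)). Qed.

Definition Sigma : Functor (Fib a) (Fib b).
Proof.
refine (@MkFunctor (Fib a) (Fib b) (fun X => ol_cod (ocl f X)) Sigma_mor _ _).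
- by move=> X; apply: Sigma_mor_eq; rewrite /= comp_idl comp_idr.
- move=> X Y Z v u; apply: Sigma_mor_eq => /=.
  by rewrite -comp_assoc Sigma_morP !comp_assoc Sigma_morP.
Defined.
End Pushing.

Section BeckChevalley.
Context (cl : cleavage) (ocl : opcleavage).

(* Component at X of the canonical transformation Sigma_pF Delta_pE -> Delta_q Sigma_p:
   the unique vertical t with  (lift of q) o t o (oplift of pF) = (oplift of p) o (lift of pE). *)
Definition bc_map (Eb Fb Bb Qb : B) (p : Hom Eb Bb) (q : Hom Fb Bb)
    (pE : Hom Qb Eb) (pF : Hom Qb Fb) (e : p ∘ pE = q ∘ pF) (X : Fib Eb) :
    Hom (Sigma ocl pF (Delta cl pE X)) (Delta cl q (Sigma ocl p X)) :=
  cart_fill (cl_cart (cl q (Sigma ocl p X)))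
    (opcart_fill (ol_opcart (ocl pF (Delta cl pE X)))
      (fcomp (ol_mor (ocl p X)) (cl_mor (cl pE X))) (eq_sym e))
    (comp_idr q).

Definition beck_chevalley : Prop :=
  forall (Eb Fb Bb Qb : B) (p : Hom Eb Bb) (q : Hom Fb Bb)
    (pE : Hom Qb Eb) (pF : Hom Qb Fb) (h : is_pullback p q pE pF) (X : Fib Eb),
  is_iso (bc_map (proj1 h) X).

(* The canonical isomorphism Sigma_b Sigma_a X -> Sigma_(b o a) X. *)
Definition Sigma_compose (A1 A2 A3 : B) (b : Hom A2 A3) (a : Hom A1 A2) (X : Fib A1) :
    Hom (Sigma ocl b (Sigma ocl a X)) (Sigma ocl (b ∘ a) X) :=
  opcart_fill (ol_opcart (ocl b (Sigma ocl a X)))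
    (opcart_fill (ol_opcart (ocl a X)) (ol_mor (ocl (b ∘ a) X)) eq_refl)
    (comp_idl b).

(* The canonical isomorphism X -> Sigma_id X. *)
Definition Sigma_unit (A : B) (X : Fib A) : Hom X (Sigma ocl (idm A) X) :=
  ol_mor (ocl (idm A) X).
End BeckChevalley.

(* A functor iota : B -> E with pi o iota = id, the equation of functors being
   written out on objects and on morphisms. *)
Record section := MkSection {
  sec_fun :> Functor B E;
  sec_ob : forall b, pi (sec_fun b) = b;
  sec_mor : forall (a b : B) (f : Hom a b),
    eq_hom (sec_ob b) ∘ fun_mor pi (fun_mor sec_fun f) = f ∘ eq_hom (sec_ob a) }.

Definition at_fib (iota : section) (b : B) : Fib b := Fob (sec_ob iota b).

(* The canonical comparison iota A -> Delta_f (iota B) induced by iota f. *)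
Definition sec_cmp (cl : cleavage) (iota : section) (a b : B) (f : Hom a b) :
    Hom (at_fib iota a) (Delta cl f (at_fib iota b)) :=
  cart_fill (cl_cart (cl a b f (at_fib iota b)))
    (@Fhom a b f (at_fib iota a) (at_fib iota b) (fun_mor iota f) (sec_mor iota f))
    (comp_idr f).

Definition preserved_by_pullback (cl : cleavage) (iota : section) : Prop :=
  forall (a b : B) (f : Hom a b), is_iso (sec_cmp cl iota f).
End Fibres.

(** * Pseudo double categories *)

(* Vertical category, horizontal 1-cells with their composites (in diagrammatic order)
   and units, and 2-cells with their vertical sides. *)
Record dbl_data := MkDblData {
  vert : Category;
  hor : vert -> vert -> Type;
  cell : forall A B A' B' : vert, hor A B -> hor A' B' -> Type;
  csrc : forall A B A' B' (m : hor A B) (n : hor A' B'), cell m n -> Hom A A';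
  ctgt : forall A B A' B' (m : hor A B) (n : hor A' B'), cell m n -> Hom B B';
  hunit : forall A, hor A A;
  hcomp : forall A B C, hor A B -> hor B C -> hor A C }.

Notation "m ⊙ n" := (hcomp m n) (at level 40, left associativity).

Record pseudo_double (D : dbl_data) := MkPseudoDouble {
  cid : forall (A B : vert D) (m : hor A B), cell m m;
  ccomp : forall (A B A' B' A'' B'' : vert D)
    (m : hor A B) (n : hor A' B') (p : hor A'' B''), cell n p -> cell m n -> cell m p;
  ccomp_idl : forall (A B A' B' : vert D) (m : hor A B) (n : hor A' B') (c : cell m n),
    ccomp (cid n) c = c;
  ccomp_idr : forall (A B A' B' : vert D) (m : hor A B) (n : hor A' B') (c : cell m n),
    ccomp c (cid m) = c;
  ccomp_assoc : forall (A1 B1 A2 B2 A3 B3 A4 B4 : vert D)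
    (m1 : hor A1 B1) (m2 : hor A2 B2) (m3 : hor A3 B3) (m4 : hor A4 B4)
    (c : cell m3 m4) (b : cell m2 m3) (a : cell m1 m2),
    ccomp c (ccomp b a) = ccomp (ccomp c b) a;
  csrc_id : forall (A B : vert D) (m : hor A B), csrc (cid m) = idm A;
  ctgt_id : forall (A B : vert D) (m : hor A B), ctgt (cid m) = idm B;
  csrc_comp : forall (A B A' B' A'' B'' : vert D)
    (m : hor A B) (n : hor A' B') (p : hor A'' B'') (d : cell n p) (c : cell m n),
    csrc (ccomp d c) = csrc d ∘ csrc c;
  ctgt_comp : forall (A B A' B' A'' B'' : vert D)
    (m : hor A B) (n : hor A' B') (p : hor A'' B'') (d : cell n p) (c : cell m n),
    ctgt (ccomp d c) = ctgt d ∘ ctgt c;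

  hunitc : forall (A A' : vert D) (u : Hom A A'), cell (hunit A) (hunit A');
  csrc_hunitc : forall (A A' : vert D) (u : Hom A A'), csrc (hunitc u) = u;
  ctgt_hunitc : forall (A A' : vert D) (u : Hom A A'), ctgt (hunitc u) = u;
  hunitc_id : forall A : vert D, hunitc (idm A) = cid (hunit A);
  hunitc_comp : forall (A A' A'' : vert D) (v : Hom A' A'') (u : Hom A A'),
    hunitc (v ∘ u) = ccomp (hunitc v) (hunitc u);

  hcompc : forall (A B C A' B' C' : vert D) (m : hor A B) (n : hor B C)
    (m' : hor A' B') (n' : hor B' C') (c : cell m m') (d : cell n n'),
    ctgt c = csrc d -> cell (m ⊙ n) (m' ⊙ n');
  csrc_hcompc : forall (A B C A' B' C' : vert D) (m : hor A B) (n : hor B C)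
    (m' : hor A' B') (n' : hor B' C') (c : cell m m') (d : cell n n') (e : ctgt c = csrc d),
    csrc (hcompc e) = csrc c;
  ctgt_hcompc : forall (A B C A' B' C' : vert D) (m : hor A B) (n : hor B C)
    (m' : hor A' B') (n' : hor B' C') (c : cell m m') (d : cell n n') (e : ctgt c = csrc d),
    ctgt (hcompc e) = ctgt d;
  hcompc_id : forall (A B C : vert D) (m : hor A B) (n : hor B C)
    (e : ctgt (cid m) = csrc (cid n)), hcompc e = cid (m ⊙ n);
  hcompc_comp : forall (A B C A' B' C' A'' B'' C'' : vert D)
    (m : hor A B) (n : hor B C) (m' : hor A' B') (n' : hor B' C')
    (m'' : hor A'' B'') (n'' : hor B'' C'')
    (c' : cell m' m'') (c : cell m m') (d' : cell n' n'') (d : cell n n')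
    (e : ctgt (ccomp c' c) = csrc (ccomp d' d)) (e1 : ctgt c' = csrc d') (e0 : ctgt c = csrc d),
    hcompc e = ccomp (hcompc e1) (hcompc e0);

  hassoc : forall (A B C D' : vert D) (m : hor A B) (n : hor B C) (p : hor C D'),
    cell ((m ⊙ n) ⊙ p) (m ⊙ (n ⊙ p));
  csrc_hassoc : forall (A B C D' : vert D) (m : hor A B) (n : hor B C) (p : hor C D'),
    csrc (hassoc m n p) = idm A;
  ctgt_hassoc : forall (A B C D' : vert D) (m : hor A B) (n : hor B C) (p : hor C D'),
    ctgt (hassoc m n p) = idm D';
  hassoc_iso : forall (A B C D' : vert D) (m : hor A B) (n : hor B C) (p : hor C D'),
    exists i : cell (m ⊙ (n ⊙ p)) ((m ⊙ n) ⊙ p),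
    ccomp i (hassoc m n p) = cid _ /\ ccomp (hassoc m n p) i = cid _;
  hassoc_nat : forall (A B C D' A1 B1 C1 D1 : vert D)
    (m : hor A B) (n : hor B C) (p : hor C D')
    (m1 : hor A1 B1) (n1 : hor B1 C1) (p1 : hor C1 D1)
    (a : cell m m1) (b : cell n n1) (c : cell p p1)
    (eab : ctgt a = csrc b) (ebc : ctgt b = csrc c)
    (e1 : ctgt (hcompc eab) = csrc c) (e2 : ctgt a = csrc (hcompc ebc)),
    ccomp (hassoc m1 n1 p1) (hcompc e1) = ccomp (hcompc e2) (hassoc m n p);

  hlunit : forall (A B : vert D) (m : hor A B), cell (hunit A ⊙ m) m;
  csrc_hlunit : forall (A B : vert D) (m : hor A B), csrc (hlunit m) = idm A;
  ctgt_hlunit : forall (A B : vert D) (m : hor A B), ctgt (hlunit m) = idm B;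
  hlunit_iso : forall (A B : vert D) (m : hor A B),
    exists i : cell m (hunit A ⊙ m),
    ccomp i (hlunit m) = cid _ /\ ccomp (hlunit m) i = cid _;
  hlunit_nat : forall (A B A' B' : vert D) (m : hor A B) (n : hor A' B') (c : cell m n)
    (e : ctgt (hunitc (csrc c)) = csrc c),
    ccomp (hlunit n) (hcompc e) = ccomp c (hlunit m);

  hrunit : forall (A B : vert D) (m : hor A B), cell (m ⊙ hunit B) m;
  csrc_hrunit : forall (A B : vert D) (m : hor A B), csrc (hrunit m) = idm A;
  ctgt_hrunit : forall (A B : vert D) (m : hor A B), ctgt (hrunit m) = idm B;
  hrunit_iso : forall (A B : vert D) (m : hor A B),
    exists i : cell m (m ⊙ hunit B),
    ccomp i (hrunit m) = cid _ /\ ccomp (hrunit m) i = cid _;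
  hrunit_nat : forall (A B A' B' : vert D) (m : hor A B) (n : hor A' B') (c : cell m n)
    (e : ctgt c = csrc (hunitc (ctgt c))),
    ccomp (hrunit n) (hcompc e) = ccomp c (hrunit m);

  pentagon : forall (A0 A1 A2 A3 A4 : vert D)
    (m : hor A0 A1) (n : hor A1 A2) (p : hor A2 A3) (q : hor A3 A4)
    (e1 : ctgt (hassoc m n p) = csrc (cid q)) (e2 : ctgt (cid m) = csrc (hassoc n p q)),
    ccomp (hcompc e2) (ccomp (hassoc m (n ⊙ p) q) (hcompc e1)) =
    ccomp (hassoc m n (p ⊙ q)) (hassoc (m ⊙ n) p q);
  triangle : forall (A B C : vert D) (m : hor A B) (n : hor B C)
    (e1 : ctgt (hrunit m) = csrc (cid n)) (e2 : ctgt (cid m) = csrc (hlunit n)),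
    ccomp (hcompc e2) (hassoc m (hunit B) n) = hcompc e1 }.

Record htot (D : dbl_data) := MkHtot {
  hs : vert D;
  ht : vert D;
  harr :> hor hs ht }.

Definition hcat (D : dbl_data) (S : pseudo_double D) : Category :=
  @MkCategory (htot D) (fun m n => cell m n) (fun m => cid S m)
    (fun m n p d c => ccomp S d c)
    (fun m n c => ccomp_idl S c) (fun m n c => ccomp_idr S c)
    (fun m n p q c b a => ccomp_assoc S c b a).

Definition src_functor (D : dbl_data) (S : pseudo_double D) : Functor (hcat S) (vert D) :=
  @MkFunctor (hcat S) (vert D) (fun m => hs m) (fun m n c => csrc c)
    (fun m => csrc_id S m) (fun m n p d c => csrc_comp S d c).

Definition tgt_functor (D : dbl_data) (S : pseudo_double D) : Functor (hcat S) (vert D) :=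
  @MkFunctor (hcat S) (vert D) (fun m => ht m) (fun m n c => ctgt c)
    (fun m => ctgt_id S m) (fun m n p d c => ctgt_comp S d c).

(** * Strict double functors and double fibrations *)

Record dbl_map (D D' : dbl_data) := MkDblMap {
  mv : Functor (vert D) (vert D');
  mh : forall A B : vert D, hor A B -> hor (mv A) (mv B);
  mc : forall (A B A' B' : vert D) (m : hor A B) (n : hor A' B'),
    cell m n -> cell (mh m) (mh n) }.

(* Equality of 2-cells whose horizontal boundaries are not syntactically the same. *)
Inductive same_cell (D : dbl_data) (A B A' B' : vert D) (m : hor A B) (n : hor A' B')
    (c : cell m n) : forall (m' : hor A B) (n' : hor A' B'), cell m' n' -> Prop :=
  same_cell_refl : same_cell c c.

Record is_strict_double_functor (D D' : dbl_data) (S : pseudo_double D) (S' : pseudo_double D')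
    (F : dbl_map D D') : Prop := MkStrict {
  str_src : forall (A B A' B' : vert D) (m : hor A B) (n : hor A' B') (c : cell m n),
    csrc (mc F c) = fun_mor (mv F) (csrc c);
  str_tgt : forall (A B A' B' : vert D) (m : hor A B) (n : hor A' B') (c : cell m n),
    ctgt (mc F c) = fun_mor (mv F) (ctgt c);
  str_id : forall (A B : vert D) (m : hor A B), mc F (cid S m) = cid S' (mh F m);
  str_comp : forall (A B A' B' A'' B'' : vert D)
    (m : hor A B) (n : hor A' B') (p : hor A'' B'') (d : cell n p) (c : cell m n),
    mc F (ccomp S d c) = ccomp S' (mc F d) (mc F c);
  str_hunit : forall A : vert D, mh F (hunit A) = hunit (mv F A);
  str_hunitc : forall (A A' : vert D) (u : Hom A A'),
    same_cell (mc F (hunitc S u)) (hunitc S' (fun_mor (mv F) u));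
  str_hcomp : forall (A B C : vert D) (m : hor A B) (n : hor B C),
    mh F (m ⊙ n) = mh F m ⊙ mh F n;
  str_hcompc : forall (A B C A' B' C' : vert D) (m : hor A B) (n : hor B C)
    (m' : hor A' B') (n' : hor B' C') (c : cell m m') (d : cell n n')
    (e : ctgt c = csrc d) (e' : ctgt (mc F c) = csrc (mc F d)),
    same_cell (mc F (hcompc S e)) (hcompc S' e');
  str_hassoc : forall (A B C D0 : vert D) (m : hor A B) (n : hor B C) (p : hor C D0),
    same_cell (mc F (hassoc S m n p)) (hassoc S' (mh F m) (mh F n) (mh F p));
  str_hlunit : forall (A B : vert D) (m : hor A B),
    same_cell (mc F (hlunit S m)) (hlunit S' (mh F m));
  str_hrunit : forall (A B : vert D) (m : hor A B),
    same_cell (mc F (hrunit S m)) (hrunit S' (mh F m)) }.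

Section DoubleFibration.
Context (D D' : dbl_data) (S : pseudo_double D) (S' : pseudo_double D') (F : dbl_map D D').
Context (HF : is_strict_double_functor S S' F).

Definition hor_functor : Functor (hcat S) (hcat S') :=
  @MkFunctor (hcat S) (hcat S') (fun m => MkHtot (mh F m)) (fun m n c => mc F c)
    (fun m => str_id HF m) (fun m n p d c => str_comp HF d c).

(* Preservation of the cleavages by source and target: the side of the chosen lift of a
   2-cell at n is the chosen lift of the side, as arrows with common codomain. *)
Definition src_preserves (c0 : cleavage (mv F)) (c1 : cleavage hor_functor) : Prop :=
  forall (m : hcat S') (n : hcat S) (c : Hom m (hor_functor n)),
  let l1 := c1 m (hor_functor n) c (@Fob _ _ hor_functor _ n eq_refl) in
  let l0 := c0 (src_functor S' m) (mv F (src_functor S n)) (fun_mor (src_functor S') c)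
              (@Fob _ _ (mv F) _ (src_functor S n) eq_refl) in
  existT (fun X => Hom X (src_functor S n))
    (src_functor S (cl_dom l1)) (fun_mor (src_functor S) (cl_mor l1)) =
  existT (fun X => Hom X (src_functor S n)) (fobj (cl_dom l0)) (fmor (cl_mor l0)).

Definition tgt_preserves (c0 : cleavage (mv F)) (c1 : cleavage hor_functor) : Prop :=
  forall (m : hcat S') (n : hcat S) (c : Hom m (hor_functor n)),
  let l1 := c1 m (hor_functor n) c (@Fob _ _ hor_functor _ n eq_refl) in
  let l0 := c0 (tgt_functor S' m) (mv F (tgt_functor S n)) (fun_mor (tgt_functor S') c)
              (@Fob _ _ (mv F) _ (tgt_functor S n) eq_refl) in
  existT (fun X => Hom X (tgt_functor S n))
    (tgt_functor S (cl_dom l1)) (fun_mor (tgt_functor S) (cl_mor l1)) =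
  existT (fun X => Hom X (tgt_functor S n)) (fobj (cl_dom l0)) (fmor (cl_mor l0)).

Definition hunit_cartesian : Prop :=
  forall (A A' : vert D) (u : Hom A A'), is_cartesian (mv F) u ->
  is_cartesian hor_functor
    (hunitc S u : @Hom (hcat S) (MkHtot (hunit A)) (MkHtot (hunit A'))).

(* Given cleavages preserved by source and target, the Cartesian arrows of the category of
   composable pairs of 2-cells are the pairs of Cartesian arrows. *)
Definition hcomp_cartesian : Prop :=
  forall (A B C A' B' C' : vert D) (m : hor A B) (n : hor B C)
    (m' : hor A' B') (n' : hor B' C') (c : cell m m') (d : cell n n') (e : ctgt c = csrc d),
  is_cartesian hor_functor (c : @Hom (hcat S) (MkHtot m) (MkHtot m')) ->
  is_cartesian hor_functor (d : @Hom (hcat S) (MkHtot n) (MkHtot n')) ->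
  is_cartesian hor_functor
    (hcompc S e : @Hom (hcat S) (MkHtot (m ⊙ n)) (MkHtot (m' ⊙ n'))).

(* The existence of the cleavages says that both components are Grothendieck fibrations. *)
Definition is_double_fibration : Prop :=
  (exists (c0 : cleavage (mv F)) (c1 : cleavage hor_functor),
     src_preserves c0 c1 /\ tgt_preserves c0 c1) /\
  hunit_cartesian /\ hcomp_cartesian.
End DoubleFibration.

(** * Sub-double categories with the same horizontal 1-cells *)

Section SubDouble.
Context (D : dbl_data) (S : pseudo_double D).
Context (P : forall (A B A' B' : vert D) (m : hor A B) (n : hor A' B'), cell m n -> Prop).

Definition sub_data : dbl_data :=
  @MkDblData (vert D) (@hor D)
    (fun A B A' B' m n => {c : cell m n | P c})
    (fun A B A' B' m n c => csrc (proj1_sig c))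
    (fun A B A' B' m n c => ctgt (proj1_sig c))
    (@hunit D) (@hcomp D).

Record closed_cells : Prop := MkClosed {
  closed_id : forall (A B : vert D) (m : hor A B), P (cid S m);
  closed_comp : forall (A B A' B' A'' B'' : vert D)
    (m : hor A B) (n : hor A' B') (p : hor A'' B'') (d : cell n p) (c : cell m n),
    P d -> P c -> P (ccomp S d c);
  closed_hunitc : forall (A A' : vert D) (u : Hom A A'), P (hunitc S u);
  closed_hcompc : forall (A B C A' B' C' : vert D) (m : hor A B) (n : hor B C)
    (m' : hor A' B') (n' : hor B' C') (c : cell m m') (d : cell n n') (e : ctgt c = csrc d),
    P c -> P d -> P (hcompc S e);
  closed_hassoc : forall (A B C D' : vert D) (m : hor A B) (n : hor B C) (p : hor C D'),
    P (hassoc S m n p);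
  closed_hlunit : forall (A B : vert D) (m : hor A B), P (hlunit S m);
  closed_hrunit : forall (A B : vert D) (m : hor A B), P (hrunit S m);
  closed_inv : forall (A B A' B' : vert D) (m : hor A B) (n : hor A' B')
    (c : cell m n) (d : cell n m),
    ccomp S d c = cid S m -> ccomp S c d = cid S n -> P c -> P d }.

Lemma sub_eq (A B A' B' : vert D) (m : hor A B) (n : hor A' B') (c d : {c : cell m n | P c}) :
  proj1_sig c = proj1_sig d -> c = d.
Proof.
case: c d => [c pc] [d pd] /= e; subst d; congr exist; exact: proof_irrelevance.
Qed.

Context (H : closed_cells).

Lemma sub_iso (A B A' B' : vert D) (m : hor A B) (n : hor A' B') (c : cell m n) (pc : P c) :
  (exists i, ccomp S i c = cid S m /\ ccomp S c i = cid S n) ->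
  exists i : {c : cell n m | P c},
    exist (@P _ _ _ _ m m) (ccomp S (proj1_sig i) c) (closed_comp H (proj2_sig i) pc) =
      exist _ (cid S m) (closed_id H m) /\
    exist (@P _ _ _ _ n n) (ccomp S c (proj1_sig i)) (closed_comp H pc (proj2_sig i)) =
      exist _ (cid S n) (closed_id H n).
Proof.
case=> i [e1 e2]; exists (exist _ i (closed_inv H e1 e2 pc)).
by split; apply: sub_eq.
Qed.

Definition sub_double : pseudo_double sub_data.
Proof.
unshelve refine (@MkPseudoDouble sub_data
  (fun A B m => exist _ (cid S m) (closed_id H m))
  (fun A B A' B' A'' B'' m n p d c =>
     exist _ (ccomp S (proj1_sig d) (proj1_sig c)) (closed_comp H (proj2_sig d) (proj2_sig c)))
  _ _ _ _ _ _ _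
  (fun A A' u => exist _ (hunitc S u) (closed_hunitc H u)) _ _ _ _
  (fun A B C A' B' C' m n m' n' c d e =>
     exist _ (hcompc S e) (closed_hcompc H e (proj2_sig c) (proj2_sig d)))
  _ _ _ _
  (fun A B C D' m n p => exist _ (hassoc S m n p) (closed_hassoc H m n p)) _ _ _ _
  (fun A B m => exist _ (hlunit S m) (closed_hlunit H m)) _ _ _ _
  (fun A B m => exist _ (hrunit S m) (closed_hrunit H m)) _ _ _ _ _ _); simpl; intros.
- by apply: sub_eq; apply: ccomp_idl.
- by apply: sub_eq; apply: ccomp_idr.
- by apply: sub_eq; apply: ccomp_assoc.
- exact: csrc_id.
- exact: ctgt_id.
- exact: csrc_comp.
- exact: ctgt_comp.
- exact: csrc_hunitc.
- exact: ctgt_hunitc.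
- by apply: sub_eq; apply: hunitc_id.
- by apply: sub_eq; apply: hunitc_comp.
- exact: csrc_hcompc.
- exact: ctgt_hcompc.
- by apply: sub_eq; apply: hcompc_id.
- by apply: sub_eq; apply: hcompc_comp.
- exact: csrc_hassoc.
- exact: ctgt_hassoc.
- exact: (sub_iso (closed_hassoc H m n p) (hassoc_iso S m n p)).
- by apply: sub_eq; apply: hassoc_nat.
- exact: csrc_hlunit.
- exact: ctgt_hlunit.
- exact: (sub_iso (closed_hlunit H m) (hlunit_iso S m)).
- by apply: sub_eq; apply: hlunit_nat.
- exact: csrc_hrunit.
- exact: ctgt_hrunit.
- exact: (sub_iso (closed_hrunit H m) (hrunit_iso S m)).
- by apply: sub_eq; apply: hrunit_nat.
- by apply: sub_eq; apply: pentagon.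
- by apply: sub_eq; apply: triangle.
Defined.
End SubDouble.

(** * The double category of spans *)

Record span (B : Category) (A C : B) := MkSpan {
  apex : B;
  lleg : Hom apex A;
  rleg : Hom apex C }.

Record span_mor (B : Category) (A C A' C' : B) (m : span A C) (n : span A' C') := MkSpanMor {
  sl : Hom A A';
  sm : Hom (apex m) (apex n);
  sr : Hom C C';
  sm_l : lleg n ∘ sm = sl ∘ lleg m;
  sm_r : rleg n ∘ sm = sr ∘ rleg m }.

Definition cartesian_span_mor (B : Category) (A C A' C' : B)
    (m : span A C) (n : span A' C') (c : span_mor m n) : Prop :=
  is_pullback (lleg n) (sl c) (sm c) (lleg m) /\ is_pullback (rleg n) (sr c) (sm c) (rleg m).

Section Span.
Context (B : Category) (pb : chosen_pullbacks B).

Lemma span_mor_eq (A C A' C' : B) (m : span A C) (n : span A' C') (c d : span_mor m n) :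
  sl c = sl d -> sm c = sm d -> sr c = sr d -> c = d.
Proof.
case: c d => [l f r e1 e2] [l' f' r' e1' e2'] /= *; subst.
by congr MkSpanMor; apply: proof_irrelevance.
Qed.

Definition span_unit (A : B) : span A A := MkSpan (idm A) (idm A).

Definition span_mid (A C D : B) (m : span A C) (n : span C D) : pullback (rleg m) (lleg n) :=
  pb (rleg m) (lleg n).

Definition span_comp (A C D : B) (m : span A C) (n : span C D) : span A D :=
  MkSpan (lleg m ∘ pb_fst (span_mid m n)) (rleg n ∘ pb_snd (span_mid m n)).

Definition span_data : dbl_data :=
  @MkDblData B (@span B) (fun A C A' C' m n => span_mor m n)
    (fun A C A' C' m n c => sl c) (fun A C A' C' m n c => sr c) span_unit span_comp.

Definition span_id (A C : B) (m : span A C) : span_mor m m :=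
  MkSpanMor (id_swap (lleg m)) (id_swap (rleg m)).

Lemma paste (X1 X2 X3 Y1 Y2 Y3 : B) (f : Hom X1 X2) (g : Hom X2 X3) (f' : Hom Y1 Y2)
    (g' : Hom Y2 Y3) (x1 : Hom X1 Y1) (x2 : Hom X2 Y2) (x3 : Hom X3 Y3) :
  x2 ∘ f = f' ∘ x1 -> x3 ∘ g = g' ∘ x2 -> x3 ∘ (g ∘ f) = (g' ∘ f') ∘ x1.
Proof. by move=> e1 e2; rewrite comp_assoc e2 -comp_assoc e1 comp_assoc. Qed.

Definition span_vcomp (A1 C1 A2 C2 A3 C3 : B)
    (m : span A1 C1) (n : span A2 C2) (p : span A3 C3)
    (d : span_mor n p) (c : span_mor m n) : span_mor m p :=
  MkSpanMor (paste (sm_l c) (sm_l d)) (paste (sm_r c) (sm_r d)).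

Definition span_unitc (A A' : B) (u : Hom A A') : span_mor (span_unit A) (span_unit A') :=
  @MkSpanMor B A A A' A' (span_unit A) (span_unit A') u u u
    (eq_sym (id_swap u)) (eq_sym (id_swap u)).

Section HComp.
Context (A C D A' C' D' : B) (m : span A C) (n : span C D) (m' : span A' C') (n' : span C' D').
Context (c : span_mor m m') (d : span_mor n n') (e : sr c = sl d).

Lemma span_hcompc_comm :
  rleg m' ∘ (sm c ∘ pb_fst (span_mid m n)) = lleg n' ∘ (sm d ∘ pb_snd (span_mid m n)).
Proof. by rewrite !comp_assoc sm_r sm_l -e -!comp_assoc pb_comm. Qed.

Definition span_hcompm : Hom (apex (span_comp m n)) (apex (span_comp m' n')) :=
  pb_med (span_mid m' n') span_hcompc_comm.

Lemma span_hcompc_l : lleg (span_comp m' n') ∘ span_hcompm = sl c ∘ lleg (span_comp m n).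
Proof. by rewrite /= -comp_assoc pb_med_fst !comp_assoc sm_l. Qed.

Lemma span_hcompc_r : rleg (span_comp m' n') ∘ span_hcompm = sr d ∘ rleg (span_comp m n).
Proof. by rewrite /= -comp_assoc pb_med_snd !comp_assoc sm_r. Qed.

Definition span_hcompc : span_mor (span_comp m n) (span_comp m' n') :=
  MkSpanMor span_hcompc_l span_hcompc_r.

Lemma span_hcompm_fst :
  pb_fst (span_mid m' n') ∘ span_hcompm = sm c ∘ pb_fst (span_mid m n).
Proof. exact: pb_med_fst. Qed.

Lemma span_hcompm_snd :
  pb_snd (span_mid m' n') ∘ span_hcompm = sm d ∘ pb_snd (span_mid m n).
Proof. exact: pb_med_snd. Qed.

Lemma span_hcompc_cartesian :
  cartesian_span_mor c -> cartesian_span_mor d -> cartesian_span_mor span_hcompc.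
Proof.
move=> [[_ cl] [_ cr]] [[_ dl] [_ dr]]; split; split;
  [exact: sm_l | move=> X x y exy | exact: sm_r | move=> X x y exy]; rewrite /= in exy.
- rewrite -comp_assoc in exy.
  have [f [[f1 f2] uf]] := cl X (pb_fst (span_mid m' n') ∘ x) y exy.
  have eg : lleg n' ∘ (pb_snd (span_mid m' n') ∘ x) = sl d ∘ (rleg m ∘ f).
    by rewrite comp_assoc -pb_comm -comp_assoc -f1 !comp_assoc sm_r e.
  have [g [[g1 g2] ug]] := dl X _ _ eg.
  have efg : rleg m ∘ f = lleg n ∘ g by rewrite g2.
  exists (pb_med (span_mid m n) efg); split.
  + split; last by rewrite /= -comp_assoc pb_med_fst.
    apply: pb_ext; rewrite comp_assoc.
    * by rewrite span_hcompm_fst -comp_assoc pb_med_fst f1.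
    * by rewrite span_hcompm_snd -comp_assoc pb_med_snd g1.
  + move=> v [v1 v2].
    have fv : f = pb_fst (span_mid m n) ∘ v.
      by apply: uf; rewrite comp_assoc -v1 -v2 /= !comp_assoc span_hcompm_fst.
    apply: pb_ext; first by rewrite pb_med_fst.
    rewrite pb_med_snd; apply: ug; split.
    * by rewrite -v1 !comp_assoc span_hcompm_snd.
    * by rewrite comp_assoc -pb_comm -comp_assoc fv.
- rewrite -comp_assoc in exy.
  have [g [[g1 g2] ug]] := dr X (pb_snd (span_mid m' n') ∘ x) y exy.
  have ef : rleg m' ∘ (pb_fst (span_mid m' n') ∘ x) = sr c ∘ (lleg n ∘ g).
    by rewrite comp_assoc pb_comm -comp_assoc -g1 !comp_assoc sm_l e.
  have [f [[f1 f2] uf]] := cr X _ _ ef.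
  exists (pb_med (span_mid m n) f2); split.
  + split; last by rewrite /= -comp_assoc pb_med_snd.
    apply: pb_ext; rewrite comp_assoc.
    * by rewrite span_hcompm_fst -comp_assoc pb_med_fst f1.
    * by rewrite span_hcompm_snd -comp_assoc pb_med_snd g1.
  + move=> v [v1 v2].
    have gv : g = pb_snd (span_mid m n) ∘ v.
      by apply: ug; rewrite comp_assoc -v1 -v2 /= !comp_assoc span_hcompm_snd.
    apply: pb_ext; last by rewrite pb_med_snd.
    rewrite pb_med_fst; apply: uf; split.
    * by rewrite -v1 !comp_assoc span_hcompm_fst.
    * by rewrite comp_assoc pb_comm -comp_assoc gv.
Qed.
End HComp.

Section Assoc.
Context (A1 A2 A3 A4 : B) (m : span A1 A2) (n : span A2 A3) (p : span A3 A4).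
Notation mn := (span_comp m n).
Notation np := (span_comp n p).

Lemma span_assoc_comm1 :
  rleg n ∘ (pb_snd (span_mid m n) ∘ pb_fst (span_mid mn p)) = lleg p ∘ pb_snd (span_mid mn p).
Proof. by rewrite comp_assoc; apply: (pb_comm (span_mid mn p)). Qed.

Definition span_assoc_r : Hom (apex (span_comp mn p)) (apex np) :=
  pb_med (span_mid n p) span_assoc_comm1.

Lemma span_assoc_comm2 :
  rleg m ∘ (pb_fst (span_mid m n) ∘ pb_fst (span_mid mn p)) = lleg np ∘ span_assoc_r.
Proof. by rewrite /= -[RHS]comp_assoc pb_med_fst !comp_assoc pb_comm. Qed.

Definition span_assocm : Hom (apex (span_comp mn p)) (apex (span_comp m np)) :=
  pb_med (span_mid m np) span_assoc_comm2.

Lemma span_assocm1 :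
  pb_fst (span_mid m np) ∘ span_assocm = pb_fst (span_mid m n) ∘ pb_fst (span_mid mn p).
Proof. exact: pb_med_fst. Qed.

Lemma span_assocm2 :
  pb_fst (span_mid n p) ∘ (pb_snd (span_mid m np) ∘ span_assocm) =
  pb_snd (span_mid m n) ∘ pb_fst (span_mid mn p).
Proof. by rewrite pb_med_snd pb_med_fst. Qed.

Lemma span_assocm3 :
  pb_snd (span_mid n p) ∘ (pb_snd (span_mid m np) ∘ span_assocm) = pb_snd (span_mid mn p).
Proof. by rewrite pb_med_snd pb_med_snd. Qed.

Lemma span_assoc_l : lleg (span_comp m np) ∘ span_assocm = idm A1 ∘ lleg (span_comp mn p).
Proof. by rewrite comp_idl /= -comp_assoc span_assocm1 !comp_assoc. Qed.

Lemma span_assoc_rr : rleg (span_comp m np) ∘ span_assocm = idm A4 ∘ rleg (span_comp mn p).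
Proof. by rewrite comp_idl /= -!comp_assoc span_assocm3. Qed.

Definition span_assoc : span_mor (span_comp mn p) (span_comp m np) :=
  MkSpanMor span_assoc_l span_assoc_rr.

Lemma span_unassoc_comm1 :
  rleg m ∘ pb_fst (span_mid m np) =
  lleg n ∘ (pb_fst (span_mid n p) ∘ pb_snd (span_mid m np)).
Proof. by rewrite comp_assoc; apply: (pb_comm (span_mid m np)). Qed.

Definition span_unassoc_l : Hom (apex (span_comp m np)) (apex mn) :=
  pb_med (span_mid m n) span_unassoc_comm1.

Lemma span_unassoc_comm2 :
  rleg mn ∘ span_unassoc_l = lleg p ∘ (pb_snd (span_mid n p) ∘ pb_snd (span_mid m np)).
Proof. by rewrite /= -[LHS]comp_assoc pb_med_snd !comp_assoc pb_comm. Qed.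

Definition span_unassocm : Hom (apex (span_comp m np)) (apex (span_comp mn p)) :=
  pb_med (span_mid mn p) span_unassoc_comm2.

Lemma span_assoc_inv1 : span_unassocm ∘ span_assocm = idm _.
Proof.
apply: pb_ext; rewrite comp_idr comp_assoc ?pb_med_fst ?pb_med_snd.
- apply: pb_ext; rewrite comp_assoc ?pb_med_fst ?pb_med_snd.
  + by [].
  + by rewrite -comp_assoc pb_med_snd pb_med_fst.
- by rewrite -comp_assoc span_assocm3.
Qed.

Lemma span_assoc_inv2 : span_assocm ∘ span_unassocm = idm _.
Proof.
apply: pb_ext; rewrite comp_idr comp_assoc.
- by rewrite span_assocm1 -comp_assoc !pb_med_fst.
- apply: pb_ext; rewrite comp_assoc.
  + by rewrite span_assocm2 -comp_assoc pb_med_fst pb_med_snd.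
  + by rewrite span_assocm3 pb_med_snd.
Qed.
End Assoc.

Section Unitors.
Context (A C : B) (m : span A C).

Lemma span_lunit_l :
  lleg m ∘ pb_snd (span_mid (span_unit A) m) = idm A ∘ lleg (span_comp (span_unit A) m).
Proof. by rewrite -pb_comm /= !comp_idl. Qed.

Lemma span_lunit_r :
  rleg m ∘ pb_snd (span_mid (span_unit A) m) = idm C ∘ rleg (span_comp (span_unit A) m).
Proof. by rewrite comp_idl. Qed.

Definition span_lunit : span_mor (span_comp (span_unit A) m) m :=
  @MkSpanMor B A C A C (span_comp (span_unit A) m) m (idm A)
    (pb_snd (span_mid (span_unit A) m)) (idm C) span_lunit_l span_lunit_r.

Lemma span_lunit_inv_comm : rleg (span_unit A) ∘ lleg m = lleg m ∘ idm (apex m).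
Proof. by rewrite comp_idr; apply: comp_idl. Qed.

Definition span_lunit_invm : Hom (apex m) (apex (span_comp (span_unit A) m)) :=
  pb_med (span_mid (span_unit A) m) span_lunit_inv_comm.

Lemma span_lunit_inv1 : span_lunit_invm ∘ sm span_lunit = idm _.
Proof.
apply: pb_ext; rewrite comp_idr comp_assoc ?pb_med_fst ?pb_med_snd /= ?comp_idl //.
by rewrite -pb_comm; apply: comp_idl.
Qed.

Lemma span_lunit_inv2 : sm span_lunit ∘ span_lunit_invm = idm _.
Proof. exact: pb_med_snd. Qed.

Lemma span_runit_l :
  lleg m ∘ pb_fst (span_mid m (span_unit C)) = idm A ∘ lleg (span_comp m (span_unit C)).
Proof. by rewrite comp_idl. Qed.

Lemma span_runit_r :
  rleg m ∘ pb_fst (span_mid m (span_unit C)) = idm C ∘ rleg (span_comp m (span_unit C)).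
Proof. by rewrite pb_comm /= !comp_idl. Qed.

Definition span_runit : span_mor (span_comp m (span_unit C)) m :=
  @MkSpanMor B A C A C (span_comp m (span_unit C)) m (idm A)
    (pb_fst (span_mid m (span_unit C))) (idm C) span_runit_l span_runit_r.

Lemma span_runit_inv_comm : rleg m ∘ idm (apex m) = lleg (span_unit C) ∘ rleg m.
Proof. by rewrite comp_idr; symmetry; apply: comp_idl. Qed.

Definition span_runit_invm : Hom (apex m) (apex (span_comp m (span_unit C))) :=
  pb_med (span_mid m (span_unit C)) span_runit_inv_comm.

Lemma span_runit_inv1 : span_runit_invm ∘ sm span_runit = idm _.
Proof.
apply: pb_ext; rewrite comp_idr comp_assoc ?pb_med_fst ?pb_med_snd /= ?comp_idl //.
by rewrite pb_comm; apply: comp_idl.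
Qed.

Lemma span_runit_inv2 : sm span_runit ∘ span_runit_invm = idm _.
Proof. exact: pb_med_fst. Qed.
End Unitors.

(* A span morphism with identity sides and invertible apex is an invertible 2-cell. *)
Lemma globular_iso (A C : B) (m n : span A C) (c : span_mor m n) (g : Hom (apex n) (apex m)) :
  sl c = idm A -> sr c = idm C -> g ∘ sm c = idm _ -> sm c ∘ g = idm _ ->
  exists i : span_mor n m, span_vcomp i c = span_id m /\ span_vcomp c i = span_id n.
Proof.
move=> el er e1 e2.
have gl : lleg m ∘ g = idm A ∘ lleg n.
  by rewrite -el -[lleg n]comp_idr -e2 [lleg n ∘ _]comp_assoc sm_l el !comp_idl.
have gr : rleg m ∘ g = idm C ∘ rleg n.
  by rewrite -er -[rleg n]comp_idr -e2 [rleg n ∘ _]comp_assoc sm_r er !comp_idl.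
exists (MkSpanMor gl gr).
by split; apply: span_mor_eq; rewrite //= ?el ?er ?comp_idl.
Qed.

Lemma re2 (X Y Z W : B) (g : Hom Y Z) (f : Hom X Y) (k : Hom X Z) :
  g ∘ f = k -> forall h : Hom W X, g ∘ (f ∘ h) = k ∘ h.
Proof. by move=> <- h; rewrite comp_assoc. Qed.

Lemma re3 (X Y Z T W : B) (g : Hom Y Z) (f : Hom X Y) (f' : Hom T X) (k : Hom T Z) :
  g ∘ (f ∘ f') = k -> forall h : Hom W T, g ∘ (f ∘ (f' ∘ h)) = k ∘ h.
Proof. by move=> <- h; rewrite !comp_assoc. Qed.

Ltac span_norm :=
  rewrite ?comp_idl ?comp_idr -?comp_assoc; repeat progress rewrite
    ?(span_assocm1, re2 (span_assocm1 _ _ _), span_assocm2, re3 (span_assocm2 _ _ _),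
      span_assocm3, re3 (span_assocm3 _ _ _), span_hcompm_fst, re2 (span_hcompm_fst _),
      span_hcompm_snd, re2 (span_hcompm_snd _)) /= ?comp_idl ?comp_idr -?comp_assoc.

Definition span_double : pseudo_double span_data.
Proof.
unshelve refine (@MkPseudoDouble span_data span_id span_vcomp
  _ _ _ _ _ _ _ span_unitc _ _ _ _ span_hcompc _ _ _ _
  span_assoc _ _ _ _ span_lunit _ _ _ _ span_runit _ _ _ _ _ _); simpl; intros; try done.
- by apply: span_mor_eq; apply: comp_idl.
- by apply: span_mor_eq; apply: comp_idr.
- by apply: span_mor_eq; apply: comp_assoc.
- by apply: span_mor_eq.
- by apply: span_mor_eq.
- apply: span_mor_eq => //=.
  by apply: pb_ext; rewrite ?span_hcompm_fst ?span_hcompm_snd comp_idr /= comp_idl.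
- apply: span_mor_eq => //=.
  apply: pb_ext; rewrite ?span_hcompm_fst ?span_hcompm_snd comp_assoc
    ?span_hcompm_fst ?span_hcompm_snd /= -!comp_assoc.
  + by rewrite span_hcompm_fst.
  + by rewrite span_hcompm_snd.
- exact: (globular_iso (c:=span_assoc m n p) eq_refl eq_refl
    (span_assoc_inv1 _ _ _) (span_assoc_inv2 _ _ _)).
- apply: span_mor_eq; rewrite /= ?comp_idl ?comp_idr //.
  apply: pb_ext; last apply: pb_ext.
  all: by span_norm.
- exact: (globular_iso (c:=span_lunit m) eq_refl eq_refl
    (span_lunit_inv1 _) (span_lunit_inv2 _)).
- apply: span_mor_eq; rewrite /= ?comp_idl ?comp_idr //.
  exact: span_hcompm_snd.
- exact: (globular_iso (c:=span_runit m) eq_refl eq_refl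
    (span_runit_inv1 _) (span_runit_inv2 _)).
- apply: span_mor_eq; rewrite /= ?comp_idl ?comp_idr //.
  exact: span_hcompm_fst.
- apply: span_mor_eq; rewrite /= ?comp_idl ?comp_idr //.
  apply: pb_ext; last (apply: pb_ext; last apply: pb_ext).
  all: by span_norm.
- apply: span_mor_eq; rewrite /= ?comp_idl ?comp_idr //.
  apply: pb_ext; span_norm; first exact: comp_idl.
  by symmetry; apply: comp_idl.
Defined.

Lemma iso_square (E F C Q : B) (p : Hom E C) (q : Hom F C) (pE : Hom Q E) (pF : Hom Q F)
    (q' : Hom C F) (pE' : Hom E Q) :
  p ∘ pE = q ∘ pF -> q' ∘ q = idm F -> pE' ∘ pE = idm Q -> pE ∘ pE' = idm E ->
  is_pullback p q pE pF.
Proof.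
move=> e eq e1 e2; split=> //; move=> X x y exy; exists (pE' ∘ x); split.
- split; first by rewrite comp_assoc e2 comp_idl.
  rewrite -[LHS]comp_idl -eq -comp_assoc !comp_assoc -[q' ∘ q ∘ pF]comp_assoc -e.
  rewrite -!comp_assoc [pE ∘ _]comp_assoc e2 comp_idl exy.
  by rewrite comp_assoc eq comp_idl.
- by move=> u [<- _]; rewrite comp_assoc e1 comp_idl.
Qed.

Lemma iso_cartesian (A C A' C' : B) (m : span A C) (n : span A' C')
    (c : span_mor m n) (d : span_mor n m) :
  span_vcomp d c = span_id m -> span_vcomp c d = span_id n -> cartesian_span_mor c.
Proof.
move=> e1 e2.
have el := f_equal (@sl _ _ _ _ _ _ _) e1; have er := f_equal (@sr _ _ _ _ _ _ _) e1.
have em := f_equal (@sm _ _ _ _ _ _ _) e1; have em' := f_equal (@sm _ _ _ _ _ _ _) e2.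
split.
- exact: iso_square (sm_l c) el em em'.
- exact: iso_square (sm_r c) er em em'.
Qed.

Lemma cartesian_closed :
  closed_cells span_double (fun A C A' C' m n c => cartesian_span_mor c).
Proof.
split; simpl.
- move=> A C m; have i : span_vcomp (span_id m) (span_id m) = span_id m.
    by apply: span_mor_eq; apply: comp_idl.
  exact: (iso_cartesian i i).
- move=> A1 C1 A2 C2 A3 C3 m n p d c [dl dr] [hl hr].
  have P : forall (X1 X2 X3 Y1 Y2 Y3 : B) (f : Hom X1 X2) (g : Hom X2 X3) (f' : Hom Y1 Y2)
    (g' : Hom Y2 Y3) (x1 : Hom X1 Y1) (x2 : Hom X2 Y2) (x3 : Hom X3 Y3),
    is_pullback x3 g' g x2 -> is_pullback x2 f' f x1 -> is_pullback x3 (g' ∘ f') (g ∘ f) x1.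
    move=> X1 X2 X3 Y1 Y2 Y3 f g f' g' x1 x2 x3 [g1 g2] [f1 f2]; split; first exact: (paste f1 g1).
    move=> X x y; rewrite -comp_assoc => /g2 [u [[u1 u2] uu]].
    have [v [[v1 v2] uv]] := f2 X u y u2.
    exists v; split; first by rewrite -comp_assoc v1.
    move=> w [w1 w2]; apply: uv; split=> //; symmetry; apply: uu.
    by rewrite comp_assoc w1 comp_assoc f1 -comp_assoc w2.
  by split; [apply: P dl hl | apply: P dr hr].
- move=> A A' u; have P : is_pullback (idm A') u u (idm A).
    split; first by rewrite comp_idl comp_idr.
    move=> X x y; rewrite comp_idl => ->; exists y; split; first by rewrite comp_idl.
    by move=> w [_ <-]; rewrite comp_idl.
  by split.
- move=> *; exact: span_hcompc_cartesian.
- move=> A1 A2 A3 A4 m n p; have [i [e1 e2]] := hassoc_iso span_double m n p.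
  exact: (iso_cartesian e1 e2).
- move=> A C m; have [i [e1 e2]] := hlunit_iso span_double m.
  exact: (iso_cartesian e1 e2).
- move=> A C m; have [i [e1 e2]] := hrunit_iso span_double m.
  exact: (iso_cartesian e1 e2).
- move=> A C A' C' m n c d e1 e2 _; exact: (iso_cartesian e2 e1).
Qed.

(* Span(B)_pb *)
Definition cart_span_data : dbl_data :=
  @sub_data span_data (fun A C A' C' m n c => cartesian_span_mor c).

Definition cart_span_double : pseudo_double cart_span_data := sub_double cartesian_closed.
End Span.

(** * Decorated spans *)

Lemma is_pullback_sym (C : Category) (E F B Q : C) (p : Hom E B) (q : Hom F B)
    (pE : Hom Q E) (pF : Hom Q F) : is_pullback p q pE pF -> is_pullback q p pF pE.
Proof.
case=> e h; split=> // X y x exy.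
have [u [[u1 u2] uu]] := h X x y (eq_sym exy).
by exists u; split=> // v [v1 v2]; apply: uu.
Qed.

Section DecoratedSpans.
Context (E B : Category) (pi : Functor E B) (pb : chosen_pullbacks B).
Context (cl : cleavage pi) (ocl : opcleavage pi) (BC : beck_chevalley cl ocl).
Context (iota : section pi) (Hiota : preserved_by_pullback cl iota).

(* Delta_q Sigma_p (iota E) ≅ Sigma_pF Delta_pE (iota E) = Sigma_pF (iota Q). *)
Definition pull_push (Eb Fb Bb Q : B) (p : Hom Eb Bb) (q : Hom Fb Bb)
    (pE : Hom Q Eb) (pF : Hom Q Fb) (h : is_pullback p q pE pF) :
    Hom (Delta cl q (Sigma ocl p (at_fib iota Eb))) (Sigma ocl pF (at_fib iota Q)) :=
  fun_mor (Sigma ocl pF) (inv (Hiota pE)) ∘ inv (BC h (at_fib iota Eb)).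

Record dec_span (A C : B) := MkDecSpan {
  dspan :> span A C;
  dsec : Hom (at_fib iota A) (Sigma ocl (lleg dspan) (at_fib iota (apex dspan))) }.

(* Delta_(f_l) s, regarded as a morphism iota A -> Sigma_a (iota E). *)
Definition pull_section (A C A' C' : B) (m : span A C) (n : span A' C') (c : span_mor m n)
    (h : cartesian_span_mor c)
    (s : Hom (at_fib iota A') (Sigma ocl (lleg n) (at_fib iota (apex n)))) :
    Hom (at_fib iota A) (Sigma ocl (lleg m) (at_fib iota (apex m))) :=
  pull_push (proj1 h) ∘ fun_mor (Delta cl (sl c)) s ∘ sec_cmp cl iota (sl c).

Definition dec_cell (A C A' C' : B) (m : dec_span A C) (n : dec_span A' C') : Type :=
  {c : {c : span_mor m n | cartesian_span_mor c} |
    dsec m = pull_section (proj2_sig c) (dsec n)}.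

Definition dec_unit (A : B) : dec_span A A :=
  @MkDecSpan A A (span_unit A) (Sigma_unit ocl (at_fib iota A)).

(* Sigma_a Delta_b (dsec n) o dsec m, regarded as a morphism into Sigma_(a o pE) of the
   section at the pullback. *)
Definition dec_comp (A C D : B) (m : dec_span A C) (n : dec_span C D) : dec_span A D :=
  @MkDecSpan A D (span_comp pb m n)
    (Sigma_compose ocl (lleg m) (pb_fst (span_mid pb m n)) (at_fib iota _)
     ∘ fun_mor (Sigma ocl (lleg m)) (pull_push (is_pullback_sym (pb_is (span_mid pb m n))))
     ∘ fun_mor (Sigma ocl (lleg m)) (fun_mor (Delta cl (rleg m)) (dsec n))
     ∘ fun_mor (Sigma ocl (lleg m)) (sec_cmp cl iota (rleg m))
     ∘ dsec m).

Definition dec_data : dbl_data :=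
  @MkDblData B dec_span dec_cell
    (fun A C A' C' m n c => sl (proj1_sig (proj1_sig c)))
    (fun A C A' C' m n c => sr (proj1_sig (proj1_sig c)))
    dec_unit dec_comp.

Definition forget_sections : dbl_map dec_data (cart_span_data pb) :=
  @MkDblMap dec_data (cart_span_data pb) (id_functor B) dspan
    (fun A C A' C' m n c => proj1_sig c).
End DecoratedSpans.

(* Main.v *)
(* Write S_a for Sigma_a (iota E), where a : E -> A. A square over g : A -> A' from a to
   a' induces a morphism S_a -> S_a' over g, called [push]. When the square is a
   pullback, Beck-Chevalley and the preservation of iota by pullback say that it is
   Cartesian, so that a reindexed section is the unique s with
   [push o s = s' o iota g]. The condition on a 2-cell of decorated spans thus becomes
   this equation in the total category, where all the required closure properties are
   diagram chases. As [push] is Cartesian, it can be cancelled: if d and d o c satisfy the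
   equation, so does c. Hence every decorated 2-cell is Cartesian over Span(B)_pb. *)

From Stdlib Require Import ssreflect IndefiniteDescription ProofIrrelevance.
Require Import Defs.

Set Implicit Arguments.
Unset Strict Implicit.
Unset Printing Implicit Defensive.

(** * Uniqueness of factorizations in the total category *)

Section Uniqueness.
Context (E B : Category) (pi : Functor E B).

(** Both [u] and [v] solve the lifting problem posed by [g ∘ v]. Taking arrows of the total category
    with [over] hypotheses, not [fhom], admits composites whose base arrow is only provably [k]. *)
Lemma cart_ext (a b c : B) (f : Hom b c) (X : fob pi b) (Y : fob pi c) (g : fhom f X Y)
    (hg : is_cartesian pi g) (Z : fob pi a) (k : Hom a b) (u v : Hom Z X) :
  over k u -> over k v -> g ∘ u = g ∘ v -> u = v.
Proof.
move=> ou ov e.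
have og : over (f ∘ k) (g ∘ v) by apply: (over_comp eq_refl (fmor_over g) ov).
have [l [_ ul]] := cart_exists hg (Fhom og) eq_refl.
have := ul (Fhom ou) e; rewrite (ul (Fhom ov) eq_refl).
by move/(f_equal (@fmor _ _ _ _ _ _ _ _)).
Qed.

Lemma opcart_ext (a b c : B) (f : Hom a b) (X : fob pi a) (Y : fob pi b) (g : fhom f X Y)
    (hg : is_opcartesian pi g) (Z : fob pi c) (k : Hom b c) (u v : Hom Y Z) :
  over k u -> over k v -> u ∘ g = v ∘ g -> u = v.
Proof.
move=> ou ov e.
have og : over (k ∘ f) (v ∘ g) by apply: (over_comp eq_refl ov (fmor_over g)).
have [l [_ ul]] := opcart_exists hg (Fhom og) eq_refl.
have := ul (Fhom ou) e; rewrite (ul (Fhom ov) eq_refl).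
by move/(f_equal (@fmor _ _ _ _ _ _ _ _)).
Qed.

Lemma cart_fillP (a b c : B) (f : Hom b c) (X : fob pi b) (Y : fob pi c) (g : fhom f X Y)
    (hg : is_cartesian pi g) (Z : fob pi a) (h' : Hom a c) (h : fhom h' Z Y) (k : Hom a b)
    (e : f ∘ k = h') : fmor g ∘ cart_fill hg h e = fmor h.
Proof. exact: (theP (cart_exists hg h e)). Qed.

Lemma opcart_fillP (a b c : B) (f : Hom a b) (X : fob pi a) (Y : fob pi b) (g : fhom f X Y)
    (hg : is_opcartesian pi g) (Z : fob pi c) (h' : Hom a c) (h : fhom h' X Z) (k : Hom b c)
    (e : k ∘ f = h') : fmor (opcart_fill hg h e) ∘ g = fmor h.
Proof. exact: (theP (opcart_exists hg h e)). Qed.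

Lemma fmor_comp (b : B) (X Y Z : Fib pi b) (v : Hom Y Z) (u : Hom X Y) :
  fmor (v ∘ u) = fmor v ∘ fmor u.
Proof. by []. Qed.

Lemma over_fun_mor (X Y : E) (g : Hom X Y) :
  over (fun_mor pi g) (X:=Fob (b:=pi X) eq_refl) (Y:=Fob (b:=pi Y) eq_refl) g.
Proof. by rewrite /over /= comp_idl comp_idr. Qed.

End Uniqueness.

Lemma invK (C : Category) (X Y : C) (f : Hom X Y) (h : is_iso f) : inv h ∘ f = idm X.
Proof. by rewrite /inv; case: constructive_indefinite_description => g []. Qed.

Lemma invKr (C : Category) (X Y : C) (f : Hom X Y) (h : is_iso f) : f ∘ inv h = idm Y.
Proof. by rewrite /inv; case: constructive_indefinite_description => g []. Qed.

(** * Morphisms induced by squares, and reindexing of sections *)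

Section PullPush.
Context (E B : Category) (pi : Functor E B).
Context (cl : cleavage pi) (ocl : opcleavage pi) (BC : beck_chevalley cl ocl).
Context (iota : section pi) (Hiota : preserved_by_pullback cl iota).

Notation io := (at_fib iota).

Definition sigma_io (X A : B) (a : Hom X A) : fob pi A := Sigma ocl a (io X).

Definition oplift (X A : B) (a : Hom X A) : fhom a (io X) (sigma_io a) := ol_mor (ocl a (io X)).

Definition sec_lift (X Y : B) (f : Hom X Y) : fhom f (io X) (io Y) :=
  @Fhom _ _ pi X Y f (io X) (io Y) (fun_mor iota f) (sec_mor iota f).

Lemma sec_lift_comp (X Y Z : B) (g : Hom Y Z) (f : Hom X Y) :
  fmor (sec_lift (g ∘ f)) = fmor (sec_lift g) ∘ sec_lift f.
Proof. exact: (fun_comp iota g f). Qed.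

Lemma sec_lift_id (X : B) : fmor (sec_lift (idm X)) = idm _.
Proof. exact: (fun_id iota X). Qed.

(** The basic test used below: a morphism out of [sigma_io a] is checked on [iota X]. *)
Lemma oplift_ext (X A C : B) (a : Hom X A) (Z : fob pi C) (g : Hom A C)
    (u v : @Hom E (sigma_io a) Z) :
  over g u -> over g v -> u ∘ oplift a = v ∘ oplift a -> u = v.
Proof. exact: (opcart_ext (ol_opcart (o:=ocl a (io X)))). Qed.

Section Squares.
Context (X Y A C : B) (p : Hom Y C) (q : Hom A C) (f : Hom X Y) (a : Hom X A).

Definition push (e : p ∘ f = q ∘ a) : fhom q (sigma_io a) (sigma_io p) :=
  opcart_fill (ol_opcart (o:=ocl a (io X))) (fcomp (oplift p) (sec_lift f)) (eq_sym e).

Lemma pushP (e : p ∘ f = q ∘ a) :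
  fmor (push e) ∘ oplift a = fmor (oplift p) ∘ sec_lift f.
Proof. exact: opcart_fillP. Qed.

Context (h : is_pullback p q f a).

(** The two-sided inverse of [pull_push], by [pull_pushK] and [push_pullK]; it is built without
    chosen inverses, so chases can compute with it. *)
Definition push_pull : @Hom (Fib pi A) (sigma_io a) (Delta cl q (sigma_io p)) :=
  bc_map cl ocl (proj1 h) (io Y) ∘ fun_mor (Sigma ocl a) (sec_cmp cl iota f).

(** On [oplift a] both sides become [oplift p] after [sec_lift f], because [bc_map] and [sec_cmp]
    are themselves defined by factorizations. *)
Lemma push_pullP : fmor (push (proj1 h)) = cl_mor (cl q (sigma_io p)) ∘ fmor push_pull.
Proof.
apply: (@oplift_ext _ _ _ a _ q); first exact: fmor_over.
- exact: (over_comp (comp_idr q) (fmor_over _) (fmor_over _)).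
- have bcP : cl_mor (cl q (sigma_io p)) ∘ fmor (bc_map cl ocl (proj1 h) (io Y)) ∘
      ol_mor (ocl a (Delta cl f (io Y))) = fmor (oplift p) ∘ cl_mor (cl f (io Y)).
    by rewrite /bc_map (cart_fillP (cl_cart (c:=cl q (sigma_io p)))) opcart_fillP.
  rewrite pushP fmor_comp -!comp_assoc.
  rewrite (Sigma_morP ocl a (sec_cmp cl iota f)) !comp_assoc bcP.
  rewrite -comp_assoc; congr (_ ∘ _); symmetry; exact: cart_fillP.
Qed.

Lemma pull_pushK : push_pull ∘ pull_push BC Hiota h = idm (Delta cl q (sigma_io p)).
Proof.
rewrite /push_pull /pull_push -comp_assoc [X in _ ∘ X]comp_assoc -fun_comp invKr.
by rewrite fun_id comp_idl invKr.
Qed.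

Lemma push_pullK : pull_push BC Hiota h ∘ push_pull = idm (sigma_io a : Fib pi A).
Proof.
rewrite /push_pull /pull_push -comp_assoc [X in _ ∘ X]comp_assoc invK comp_idl.
by rewrite -fun_comp invK fun_id.
Qed.

Lemma push_pull_push :
  fmor (push (proj1 h)) ∘ fmor (pull_push BC Hiota h) = cl_mor (cl q (sigma_io p)).
Proof. by rewrite push_pullP -comp_assoc -fmor_comp pull_pushK; apply: comp_idr. Qed.

(** By [push_pullP], [push] is a chosen Cartesian lift preceded by the isomorphism [push_pull], and
    each factor can be cancelled. *)
Lemma push_ext (D : B) (Z : fob pi D) (k : Hom D A) (u v : @Hom E Z (sigma_io a)) :
  over k u -> over k v -> push (proj1 h) ∘ u = push (proj1 h) ∘ v -> u = v.
Proof.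
move=> ou ov; rewrite push_pullP -[_ ∘ u]comp_assoc -[_ ∘ v]comp_assoc => e.
have et : fmor push_pull ∘ u = fmor push_pull ∘ v.
  apply: (@cart_ext _ _ _ _ _ _ _ _ _ _ (cl_cart (c:=cl q (sigma_io p))) _ k _ _ _ _ e);
    [move: ou | move: ov]; exact: (over_comp (comp_idl k) (fmor_over push_pull)).
have r := f_equal (@fmor _ _ _ _ _ _ _ _) push_pullK.
rewrite fmor_comp in r.
by rewrite -[u]comp_idl -[v]comp_idl -[idm _]r -comp_assoc et comp_assoc.
Qed.

Definition pull_sec (s : @Hom (Fib pi C) (io C) (sigma_io p)) :
    @Hom (Fib pi A) (io A) (sigma_io a) :=
  pull_push BC Hiota h ∘ fun_mor (Delta cl q) s ∘ sec_cmp cl iota q.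

Lemma pull_secP (s : @Hom (Fib pi C) (io C) (sigma_io p)) :
  push (proj1 h) ∘ fmor (pull_sec s) = fmor s ∘ sec_lift q.
Proof.
rewrite /pull_sec !fmor_comp 2!comp_assoc push_pull_push.
rewrite (Delta_morP cl q s) -comp_assoc; congr (_ ∘ _).
exact: cart_fillP.
Qed.

(** Existence is [pull_secP], uniqueness is [push_ext]. This trades the Beck-Chevalley inverses for
    an equation in the total category. *)
Lemma pull_sec_eq (s : @Hom (Fib pi C) (io C) (sigma_io p))
    (t : @Hom (Fib pi A) (io A) (sigma_io a)) :
  push (proj1 h) ∘ fmor t = fmor s ∘ sec_lift q <-> t = pull_sec s.
Proof.
split=> [e|->]; last exact: pull_secP.
apply: fhom_eq; apply: push_ext (fmor_over _) (fmor_over _) _.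
by rewrite e pull_secP.
Qed.
End Squares.

Lemma push_id (X A : B) (a : Hom X A) (e : a ∘ idm X = idm A ∘ a) :
  fmor (push e) = idm _.
Proof.
apply: (@oplift_ext _ _ _ a _ (idm A)); [exact: fmor_over | exact: over_id |].
by rewrite pushP sec_lift_id comp_idl comp_idr.
Qed.

(** Functoriality of [push], tested on [oplift a]. The composites are variables constrained by
    equations, so that squares need no transport. *)
Lemma push_comp (X Y Z A C D : B) (a : Hom X A) (p : Hom Y C) (r : Hom Z D)
    (f : Hom X Y) (f' : Hom Y Z) (f'' : Hom X Z) (g : Hom A C) (g' : Hom C D) (g'' : Hom A D)
    (e : p ∘ f = g ∘ a) (e' : r ∘ f' = g' ∘ p) (e'' : r ∘ f'' = g'' ∘ a) :
  f' ∘ f = f'' -> g' ∘ g = g'' -> fmor (push e') ∘ fmor (push e) = fmor (push e'').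
Proof.
move=> ef eg.
apply: (@oplift_ext _ _ _ a _ g'').
- exact: over_comp eg (fmor_over _) (fmor_over _).
- exact: fmor_over.
- by rewrite -comp_assoc !pushP comp_assoc pushP -ef sec_lift_comp comp_assoc.
Qed.

(** [Sigma_compose] is the vertical morphism that this one induces on the pushforward along [a]. *)
Definition sigma_ext (X Y A : B) (a : Hom Y A) (b : Hom X Y) :
    fhom a (sigma_io b) (sigma_io (a ∘ b)) :=
  opcart_fill (ol_opcart (o:=ocl b (io X))) (oplift (a ∘ b)) eq_refl.

Lemma sigma_extP (X Y A : B) (a : Hom Y A) (b : Hom X Y) :
  fmor (sigma_ext a b) ∘ oplift b = oplift (a ∘ b).
Proof. exact: opcart_fillP. Qed.

(* [locked] keeps rewriting with associativity from unfolding the composite. *)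
Definition sigma_bind (X Y A : B) (a : Hom Y A) (b : Hom X Y)
    (t : @Hom (Fib pi Y) (io Y) (sigma_io b)) : fhom (idm A) (sigma_io a) (sigma_io (a ∘ b)) :=
  locked (Sigma_compose ocl a b (io X) ∘ fun_mor (Sigma ocl a) t).

(** So [sigma_bind a t] acts as a Kleisli extension of [t], and is determined by this because
    [oplift a] is opCartesian. *)
Lemma sigma_bindP (X Y A : B) (a : Hom Y A) (b : Hom X Y)
    (t : @Hom (Fib pi Y) (io Y) (sigma_io b)) :
  fmor (sigma_bind a t) ∘ oplift a = fmor (sigma_ext a b) ∘ fmor t.
Proof.
rewrite /sigma_bind -lock fmor_comp -comp_assoc (Sigma_morP ocl a t) comp_assoc.
congr (_ ∘ _); exact: opcart_fillP.
Qed.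

End PullPush.

(** * Span morphisms compatible with sections, and their closure properties *)

Section Sections.
Context (E B : Category) (pi : Functor E B) (pb : chosen_pullbacks B).
Context (cl : cleavage pi) (ocl : opcleavage pi) (BC : beck_chevalley cl ocl).
Context (iota : section pi) (Hiota : preserved_by_pullback cl iota).

Notation lift f := (sec_lift iota f).
Notation dspn := (dec_span ocl iota).
Notation dcomp m n := (dec_comp pb BC Hiota m n).

(** The equation of [pull_sec_eq] for the left square of [c]; being free of inverses, it makes sense
    for every span morphism. *)
Definition preserves_sections (A C A' C' : B) (m : dspn A C) (n : dspn A' C')
    (c : span_mor m n) : Prop :=
  fmor (push ocl iota (sm_l c)) ∘ fmor (dsec m) = fmor (dsec n) ∘ lift (sl c).

Lemma preserves_sectionsP (A C A' C' : B) (m : dspn A C) (n : dspn A' C') (c : span_mor m n)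
    (h : cartesian_span_mor c) :
  dsec m = pull_section BC Hiota h (dsec n) <-> preserves_sections c.
Proof.
rewrite /preserves_sections (proof_irrelevance _ (sm_l c) (proj1 (proj1 h))).
exact: iff_sym (pull_sec_eq BC Hiota (proj1 h) (dsec n) (dsec m)).
Qed.

(** The pullback square is transposed because [pull_sec] reindexes along its second leg, here
    [rleg m]. *)
Definition pulled_sec (A C D : B) (m : span A C) (n : dspn C D) :=
  locked (pull_sec BC Hiota (is_pullback_sym (pb_is (span_mid pb m n))) (dsec n)).

(** Functoriality of [Sigma] gathers the first four factors into one extension, so horizontal
    composition of sections takes a Kleisli form. *)
Lemma dsec_comp (A C D : B) (m : dspn A C) (n : dspn C D) :
  fmor (dsec (dcomp m n)) = fmor (sigma_bind (lleg m) (pulled_sec m n)) ∘ fmor (dsec m).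
Proof.
rewrite /sigma_bind /pulled_sec -!lock /pull_sec 2!fun_comp -fmor_comp; congr fmor.
by rewrite 2!comp_assoc.
Qed.

Lemma preserves_sections_id (A C : B) (m : dspn A C) :
  @preserves_sections A C A C m m (span_id m).
Proof. by rewrite /preserves_sections push_id sec_lift_id comp_idl comp_idr. Qed.

Lemma preserves_sections_comp (A1 C1 A2 C2 A3 C3 : B)
    (m : dspn A1 C1) (n : dspn A2 C2) (p : dspn A3 C3) (d : span_mor n p) (c : span_mor m n) :
  preserves_sections d -> preserves_sections c ->
  @preserves_sections _ _ _ _ m p (span_vcomp d c).
Proof.
rewrite /preserves_sections => hd hc.
rewrite -(push_comp ocl iota (sm_l c) (sm_l d) (sm_l (span_vcomp d c)) eq_refl eq_refl).
by rewrite -comp_assoc hc comp_assoc hd -comp_assoc -sec_lift_comp.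
Qed.

(** Functoriality of [push] and [lift] allows the equation for [c] to be cancelled on both sides. *)
Lemma preserves_sections_inv (A C A' C' : B) (m : dspn A C) (n : dspn A' C')
    (c : span_mor m n) (d : span_mor n m) :
  span_vcomp d c = span_id m -> span_vcomp c d = span_id n ->
  preserves_sections c -> preserves_sections d.
Proof.
move=> e1 e2; rewrite /preserves_sections => hc.
have ec : sl c ∘ sl d = idm _ := f_equal (@sl _ _ _ _ _ _ _) e2.
have hd : fmor (push ocl iota (sm_l d)) ∘ fmor (push ocl iota (sm_l c)) = idm _.
  rewrite -(push_id ocl iota (sm_l (span_id m))).
  by apply: push_comp; [exact: (f_equal (@sm _ _ _ _ _ _ _) e1)
                      | exact: (f_equal (@sl _ _ _ _ _ _ _) e1)].
have ei : fmor (lift (sl c)) ∘ lift (sl d) = idm _.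
  by rewrite -sec_lift_comp ec sec_lift_id.
rewrite -[fmor (dsec n)]comp_idr -ei.
by rewrite [fmor (dsec n) ∘ _]comp_assoc -hc !comp_assoc hd comp_idl.
Qed.

Lemma preserves_sections_cancel (A1 C1 A2 C2 A3 C3 : B)
    (m : dspn A1 C1) (n : dspn A2 C2) (p : dspn A3 C3) (d : span_mor n p) (c : span_mor m n) :
  cartesian_span_mor d -> preserves_sections d ->
  @preserves_sections _ _ _ _ m p (span_vcomp d c) -> preserves_sections c.
Proof.
rewrite /preserves_sections => h hd hdc.
apply: (@push_ext _ _ _ _ _ BC _ Hiota _ _ _ _ _ _ _ _ (proj1 h) _ _ (sl c)).
- exact: over_comp (comp_idr _) (fmor_over _) (fmor_over _).
- exact: over_comp (comp_idl _) (fmor_over _) (fmor_over _).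
- rewrite !comp_assoc (push_comp ocl iota (sm_l c) _ (sm_l (span_vcomp d c)) eq_refl eq_refl).
  rewrite (proof_irrelevance _ (proj1 (proj1 h)) (sm_l d)) hdc hd.
  by rewrite -comp_assoc -sec_lift_comp.
Qed.

Lemma preserves_sections_unit (A A' : B) (u : Hom A A') :
  @preserves_sections _ _ _ _ (dec_unit ocl iota A) (dec_unit ocl iota A') (span_unitc u).
Proof. exact: pushP. Qed.

Lemma pulled_secP (A C D : B) (m : span A C) (n : dspn C D)
    (e : lleg n ∘ pb_snd (span_mid pb m n) = rleg m ∘ pb_fst (span_mid pb m n)) :
  fmor (push ocl iota e) ∘ fmor (pulled_sec m n) = fmor (dsec n) ∘ lift (rleg m).
Proof.
rewrite (proof_irrelevance _ e (proj1 (is_pullback_sym (pb_is (span_mid pb m n))))).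
rewrite /pulled_sec -lock; exact: pull_secP.
Qed.

Lemma pulled_ext (A C D : B) (m : span A C) (n : dspn C D)
    (e : lleg n ∘ pb_snd (span_mid pb m n) = rleg m ∘ pb_fst (span_mid pb m n))
    (X : B) (Z : fob pi X) (k : Hom X (apex m))
    (u v : @Hom E Z (sigma_io ocl iota (pb_fst (span_mid pb m n)))) :
  over k u -> over k v -> push ocl iota e ∘ u = push ocl iota e ∘ v -> u = v.
Proof.
rewrite (proof_irrelevance _ e (proj1 (is_pullback_sym (pb_is (span_mid pb m n))))).
exact: push_ext.
Qed.

Lemma push_sigma_ext (X Y A X' Y' A' : B) (a : Hom Y A) (b : Hom X Y)
    (a' : Hom Y' A') (b' : Hom X' Y') (f : Hom X X') (g : Hom Y Y') (h : Hom A A')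
    (e1 : b' ∘ f = g ∘ b) (e2 : a' ∘ g = h ∘ a) (e : a' ∘ b' ∘ f = h ∘ (a ∘ b)) :
  fmor (push ocl iota e) ∘ fmor (sigma_ext ocl iota a b) =
  fmor (sigma_ext ocl iota a' b') ∘ fmor (push ocl iota e1).
Proof.
apply: (@oplift_ext _ _ _ _ _ _ _ _ _ _ (h ∘ a)).
- exact: over_comp eq_refl (fmor_over _) (fmor_over _).
- exact: over_comp e2 (fmor_over _) (fmor_over _).
- by rewrite -!comp_assoc sigma_extP !pushP comp_assoc sigma_extP.
Qed.

Lemma pulled_comm (A C D : B) (m : span A C) (n : span C D) :
  lleg n ∘ pb_snd (span_mid pb m n) = rleg m ∘ pb_fst (span_mid pb m n).
Proof. by rewrite pb_comm. Qed.

(** After the Cartesian [push] towards [lleg n'], both sides reduce to the equation for [d] preceded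
    by [lift (rleg m)]. With [f] and [g] left free, this serves both horizontal composites and the
    associator. *)
Lemma pulled_sec_nat (A C D A' C' D' : B) (m : span A C) (n : dspn C D)
    (m' : span A' C') (n' : dspn C' D') (d : span_mor n n')
    (f : Hom (apex m) (apex m'))
    (g : Hom (apex (span_comp pb m n)) (apex (span_comp pb m' n')))
    (e : pb_fst (span_mid pb m' n') ∘ g = f ∘ pb_fst (span_mid pb m n)) :
  pb_snd (span_mid pb m' n') ∘ g = sm d ∘ pb_snd (span_mid pb m n) ->
  rleg m' ∘ f = sl d ∘ rleg m -> preserves_sections d ->
  fmor (push ocl iota e) ∘ fmor (pulled_sec m n) = fmor (pulled_sec m' n') ∘ lift f.
Proof.
move=> eg ef hd.
apply: (@pulled_ext _ _ _ m' n' (pulled_comm m' n') _ _ f).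
- exact: over_comp (comp_idr f) (fmor_over _) (fmor_over _).
- exact: over_comp (comp_idl f) (fmor_over _) (fmor_over _).
- rewrite !comp_assoc pulled_secP -[RHS]comp_assoc -sec_lift_comp ef sec_lift_comp.
  rewrite [RHS]comp_assoc -hd -[RHS]comp_assoc -(pulled_secP (pulled_comm m n)).
  rewrite [RHS]comp_assoc; congr (_ ∘ _).
  have es : lleg n' ∘ (pb_snd (span_mid pb m' n') ∘ g) =
      rleg m' ∘ f ∘ pb_fst (span_mid pb m n).
    by rewrite comp_assoc pulled_comm -!comp_assoc e.
  rewrite (push_comp ocl iota e (pulled_comm m' n') es eq_refl eq_refl).
  by symmetry; apply: push_comp.
Qed.

Lemma preserves_sections_hcomp (A C D A' C' D' : B) (m : dspn A C) (n : dspn C D)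
    (m' : dspn A' C') (n' : dspn C' D') (c : span_mor m m') (d : span_mor n n')
    (e : sr c = sl d) :
  preserves_sections c -> preserves_sections d ->
  @preserves_sections _ _ _ _ (dcomp m n) (dcomp m' n') (span_hcompc pb e).
Proof.
move=> hc hd; rewrite /preserves_sections !dsec_comp.
rewrite -[RHS]comp_assoc -hc !comp_assoc; congr (_ ∘ _).
apply: (@oplift_ext _ _ _ _ _ _ _ _ _ _ (sl c)).
- exact: over_comp (comp_idr _) (fmor_over _) (fmor_over _).
- exact: over_comp (comp_idl _) (fmor_over _) (fmor_over _).
- rewrite -!comp_assoc sigma_bindP pushP.
  rewrite [RHS]comp_assoc sigma_bindP -[RHS]comp_assoc [LHS]comp_assoc.
  have e1 := span_hcompm_fst pb e.
  (* The equation for [d] enters here, with [sm c] as the map of apexes. *)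
  rewrite -(@pulled_sec_nat _ _ _ _ _ _ m n m' n' d (sm c) _ e1).
  + exact: span_hcompm_snd.
  + by rewrite -e; apply: sm_r.
  + exact: hd.
  + by rewrite [RHS]comp_assoc (push_sigma_ext e1 (sm_l c)).
Qed.

(** Moving [sigma_ext] outside reduces a statement over [A] to one over [Y]. It is tested on
    [oplift b] and then, once [t] is cancelled, on [oplift b']. *)
Lemma push_sigma_bind (X Y Z A T : B) (a : Hom Y A) (b : Hom X Y) (b' : Hom Z X)
    (d : Hom T Y) (f : Hom Z T) (t : @Hom (Fib pi X) (at_fib iota X) (sigma_io ocl iota b'))
    (e1 : d ∘ f = idm Y ∘ (b ∘ b')) (e : a ∘ d ∘ f = idm A ∘ (a ∘ b ∘ b')) :
  fmor (push ocl iota e) ∘ fmor (sigma_bind (a ∘ b) t) ∘ fmor (sigma_ext ocl iota a b) =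
  fmor (sigma_ext ocl iota a d) ∘ (fmor (push ocl iota e1) ∘ fmor (sigma_bind b t)).
Proof.
apply: (@oplift_ext _ _ _ _ _ _ _ _ _ _ a).
- apply: over_comp (comp_idl a) _ (fmor_over _).
  exact: over_comp (comp_idl _) (fmor_over _) (fmor_over _).
- apply: over_comp (comp_idr a) (fmor_over _) _.
  exact: over_comp (comp_idl _) (fmor_over _) (fmor_over _).
- rewrite -!comp_assoc sigma_extP !sigma_bindP !comp_assoc.
  rewrite -[_ ∘ oplift _ _ _]comp_assoc sigma_bindP comp_assoc; congr (_ ∘ _).
  apply: (@oplift_ext _ _ _ _ _ _ _ _ _ _ (a ∘ b)).
  + exact: over_comp (comp_idl _) (fmor_over _) (fmor_over _).
  + apply: over_comp _ _ (fmor_over _); last first.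
      exact: over_comp (comp_idr a) (fmor_over _) (fmor_over _).
    by [].
  + rewrite -!comp_assoc sigma_extP pushP -[RHS]comp_assoc sigma_extP.
    by rewrite -[RHS]comp_assoc pushP comp_assoc sigma_extP.
Qed.

Section Assoc.
Context (A1 A2 A3 A4 : B) (m : dspn A1 A2) (n : dspn A2 A3) (p : dspn A3 A4).

(** This is [pulled_sec_nat] for the identity of [p]. The square is bound existentially because
    [push] depends on its proof. *)
Lemma pulled_sec_assoc_r :
  exists e : pb_fst (span_mid pb n p) ∘ span_assoc_r pb m n p =
      pb_snd (span_mid pb m n) ∘ pb_fst (span_mid pb (dcomp m n) p),
  fmor (push ocl iota e) ∘ fmor (pulled_sec (dcomp m n) p) =
  fmor (pulled_sec n p) ∘ lift (pb_snd (span_mid pb m n)).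
Proof.
have e : pb_fst (span_mid pb n p) ∘ span_assoc_r pb m n p =
    pb_snd (span_mid pb m n) ∘ pb_fst (span_mid pb (dcomp m n) p) by exact: pb_med_fst.
exists e; apply: (@pulled_sec_nat _ _ _ _ _ _ (dcomp m n) p n p (span_id p)).
- by rewrite pb_med_snd comp_idl.
- by rewrite comp_idl.
- exact: preserves_sections_id.
Qed.

(** The core of associativity. After two tests on opCartesian lifts, what remains is that
    [span_assocm] has second projection [span_assoc_r]. *)
Lemma push_assoc_bind
    (e : pb_fst (span_mid pb m (dcomp n p)) ∘ span_assocm pb m n p =
      idm _ ∘ (pb_fst (span_mid pb m n) ∘ pb_fst (span_mid pb (dcomp m n) p))) :
  fmor (push ocl iota (pulled_comm m (dcomp n p))) ∘ fmor (push ocl iota e)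
    ∘ fmor (sigma_bind (pb_fst (span_mid pb m n)) (pulled_sec (dcomp m n) p)) =
  fmor (sigma_bind (lleg n) (pulled_sec n p)) ∘ fmor (push ocl iota (pulled_comm m n)).
Proof.
apply: (@oplift_ext _ _ _ _ _ _ _ _ _ _ (rleg m)).
- apply: over_comp (comp_idr _) _ (fmor_over _).
  exact: over_comp (comp_idr _) (fmor_over _) (fmor_over _).
- exact: over_comp (comp_idl _) (fmor_over _) (fmor_over _).
- rewrite -[LHS]comp_assoc sigma_bindP.
  rewrite -[RHS]comp_assoc pushP [RHS]comp_assoc sigma_bindP -[RHS]comp_assoc.
  have [e2 <-] := pulled_sec_assoc_r.
  rewrite !comp_assoc; congr (_ ∘ _).
  apply: (@oplift_ext _ _ _ _ _ _ _ _ _ _ (rleg m ∘ pb_fst (span_mid pb m n))).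
  + apply: over_comp eq_refl _ (fmor_over _).
    exact: over_comp (comp_idr _) (fmor_over _) (fmor_over _).
  + apply: over_comp _ (fmor_over _) (fmor_over _); exact: pulled_comm.
  + rewrite -[LHS]comp_assoc sigma_extP -[LHS]comp_assoc pushP [LHS]comp_assoc pushP.
    rewrite -[LHS]comp_assoc -sec_lift_comp.
    by rewrite -[RHS]comp_assoc pushP [RHS]comp_assoc sigma_extP pb_med_snd.
Qed.

Lemma preserves_sections_assoc :
  @preserves_sections _ _ _ _ (dcomp (dcomp m n) p) (dcomp m (dcomp n p)) (span_assoc pb m n p).
Proof.
rewrite /preserves_sections sec_lift_id comp_idr !dsec_comp !comp_assoc; congr (_ ∘ _).
have e1 : pb_fst (span_mid pb m (dcomp n p)) ∘ span_assocm pb m n p =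
    idm _ ∘ (pb_fst (span_mid pb m n) ∘ pb_fst (span_mid pb (dcomp m n) p)).
  by rewrite comp_idl; apply: span_assocm1.
apply: (@oplift_ext _ _ _ _ _ _ _ _ _ _ (idm A1)).
- apply: over_comp (comp_idl _) _ (fmor_over _).
  exact: over_comp (comp_idl _) (fmor_over _) (fmor_over _).
- exact: fmor_over.
- rewrite sigma_bindP -[LHS]comp_assoc sigma_bindP [LHS]comp_assoc.
  (* The problem moves from [A1] to the apex of [m], where [pulled_ext] applies. *)
  rewrite (push_sigma_bind _ e1) -[LHS]comp_assoc; congr (_ ∘ _).
  apply: (@pulled_ext _ _ _ m (dcomp n p) (pulled_comm m (dcomp n p)) _ _ (idm _)).
  + apply: over_comp (comp_idl _) _ (fmor_over _).
    exact: over_comp (comp_idl _) (fmor_over _) (fmor_over _).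
  + exact: fmor_over.
  + rewrite pulled_secP dsec_comp -[RHS]comp_assoc -(pulled_secP (pulled_comm m n)).
    by rewrite !comp_assoc push_assoc_bind.
Qed.
End Assoc.

Lemma preserves_sections_lunit (A C : B) (m : dspn A C) :
  @preserves_sections _ _ _ _ (dcomp (dec_unit ocl iota A) m) m (span_lunit pb m).
Proof.
rewrite /preserves_sections dsec_comp /=.
(* The section of the unit span is an [oplift], so [sigma_bindP] removes the extension. *)
rewrite -/(oplift ocl iota (idm A)) sigma_bindP comp_assoc.
(* Here [idm A] is read as the right leg of the unit span. *)
rewrite -(pulled_secP (pulled_comm (span_unit A) m)); congr (_ ∘ _).
apply: (@oplift_ext _ _ _ _ _ _ _ _ _ _ (idm A)).
- exact: over_comp (comp_idl _) (fmor_over _) (fmor_over _).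
- exact: fmor_over.
- by rewrite -comp_assoc sigma_extP !pushP.
Qed.

(** The right-hand side lies over the identity by [span_runit_inv2], and both sides push to
    [oplift (idm C)] after [lift (rleg m)]. *)
Lemma pulled_sec_unit (A C : B) (m : span A C) :
  fmor (pulled_sec m (dec_unit ocl iota C)) =
  fmor (oplift ocl iota (pb_fst (span_mid pb m (span_unit C)))) ∘ lift (span_runit_invm pb m).
Proof.
apply: (@pulled_ext _ _ _ m (dec_unit ocl iota C) (pulled_comm _ _) _ _ (idm _)).
- exact: fmor_over.
- exact: over_comp (span_runit_inv2 pb m) (fmor_over _) (fmor_over _).
- rewrite pulled_secP [RHS]comp_assoc pushP -[RHS]comp_assoc -sec_lift_comp.
  by rewrite pb_med_snd.
Qed.

Lemma preserves_sections_runit (A C : B) (m : dspn A C) :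
  @preserves_sections _ _ _ _ (dcomp m (dec_unit ocl iota C)) m (span_runit pb m).
Proof.
rewrite /preserves_sections dsec_comp sec_lift_id comp_idr comp_assoc.
rewrite -[RHS]comp_idl; congr (_ ∘ _).
apply: (@oplift_ext _ _ _ _ _ _ _ _ _ _ (idm A)).
- exact: over_comp (comp_idl _) (fmor_over _) (fmor_over _).
- exact: over_id.
- rewrite -[LHS]comp_assoc sigma_bindP comp_idl pulled_sec_unit.
  rewrite [X in _ ∘ X]comp_assoc sigma_extP [LHS]comp_assoc pushP -[LHS]comp_assoc.
  by rewrite -sec_lift_comp span_runit_inv2 sec_lift_id comp_idr.
Qed.

(** * The pseudo double category of decorated spans *)

Notation S' := (cart_span_double pb).

(* The cells of [dec_data] without the condition on sections, so that the decorated spans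
   form the sub-double category given by [preserves_sections]. *)
Definition undec_data : dbl_data :=
  @MkDblData B dspn
    (fun A C A' C' m n => cell (d:=cart_span_data pb) (dspan m) (dspan n))
    (fun A C A' C' m n c => csrc c) (fun A C A' C' m n c => ctgt c)
    (dec_unit ocl iota) (fun A C D m n => dcomp m n).

Definition undec_double : pseudo_double undec_data :=
  @MkPseudoDouble undec_data
    (fun A C m => cid S' (dspan m)) (fun _ _ _ _ _ _ m n p d c => ccomp S' d c)
    (fun _ _ _ _ m n c => ccomp_idl S' c) (fun _ _ _ _ m n c => ccomp_idr S' c)
    (fun _ _ _ _ _ _ _ _ m n p q c b a => ccomp_assoc S' c b a)
    (fun _ _ m => csrc_id S' (dspan m)) (fun _ _ m => ctgt_id S' (dspan m))
    (fun _ _ _ _ _ _ m n p d c => csrc_comp S' d c)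
    (fun _ _ _ _ _ _ m n p d c => ctgt_comp S' d c)
    (fun A A' u => hunitc S' u)
    (fun A A' u => csrc_hunitc S' u) (fun A A' u => ctgt_hunitc S' u)
    (fun A => hunitc_id S' A) (fun A A' A'' v u => hunitc_comp S' v u)
    (fun _ _ _ _ _ _ m n m' n' c d e => hcompc S' e)
    (fun _ _ _ _ _ _ m n m' n' c d e => csrc_hcompc S' e)
    (fun _ _ _ _ _ _ m n m' n' c d e => ctgt_hcompc S' e)
    (fun _ _ _ m n e => hcompc_id (p0:=S') (m:=m) (n:=n) e)
    (fun _ _ _ _ _ _ _ _ _ m n m' n' m'' n'' c' c d' d e e1 e0 => hcompc_comp (p0:=S') e e1 e0)
    (fun _ _ _ _ m n p => hassoc S' (dspan m) (dspan n) (dspan p))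
    (fun _ _ _ _ m n p => csrc_hassoc S' (dspan m) (dspan n) (dspan p))
    (fun _ _ _ _ m n p => ctgt_hassoc S' (dspan m) (dspan n) (dspan p))
    (fun _ _ _ _ m n p => hassoc_iso S' (dspan m) (dspan n) (dspan p))
    (fun _ _ _ _ _ _ _ _ m n p m1 n1 p1 a b c eab ebc e1 e2 =>
       hassoc_nat (p0:=S') (eab:=eab) (ebc:=ebc) e1 e2)
    (fun _ _ m => hlunit S' (dspan m))
    (fun _ _ m => csrc_hlunit S' (dspan m)) (fun _ _ m => ctgt_hlunit S' (dspan m))
    (fun _ _ m => hlunit_iso S' (dspan m)) (fun _ _ _ _ m n c e => hlunit_nat (p0:=S') e)
    (fun _ _ m => hrunit S' (dspan m))
    (fun _ _ m => csrc_hrunit S' (dspan m)) (fun _ _ m => ctgt_hrunit S' (dspan m))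
    (fun _ _ m => hrunit_iso S' (dspan m)) (fun _ _ _ _ m n c e => hrunit_nat (p0:=S') e)
    (fun _ _ _ _ _ m n p q e1 e2 => pentagon (p0:=S') (m:=m) (n:=n) (p:=p) (q:=q) e1 e2)
    (fun _ _ _ m n e1 e2 => triangle (p0:=S') (m:=m) (n:=n) e1 e2).

Lemma sections_closed :
  closed_cells undec_double
    (fun A C A' C' m n c => dsec m = pull_section BC Hiota (proj2_sig c) (dsec n)).
Proof.
split.
- move=> A C m; apply/preserves_sectionsP; exact: preserves_sections_id.
- move=> A C A' C' A'' C'' m n p d c /preserves_sectionsP hd /preserves_sectionsP hc.
  apply/preserves_sectionsP; exact: preserves_sections_comp.
- move=> A A' u; apply/preserves_sectionsP; exact: preserves_sections_unit.
- move=> A C D A' C' D' m n m' n' c d e /preserves_sectionsP hc /preserves_sectionsP hd.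
  apply/preserves_sectionsP; exact: preserves_sections_hcomp.
- move=> A1 A2 A3 A4 m n p; apply/preserves_sectionsP; exact: preserves_sections_assoc.
- move=> A C m; apply/preserves_sectionsP; exact: preserves_sections_lunit.
- move=> A C m; apply/preserves_sectionsP; exact: preserves_sections_runit.
- move=> A C A' C' m n c d e1 e2 /preserves_sectionsP hc; apply/preserves_sectionsP.
  have e1' := f_equal (@proj1_sig _ _) e1; have e2' := f_equal (@proj1_sig _ _) e2.
  exact: preserves_sections_inv e1' e2' hc.
Qed.

(** The type is met by conversion: [sub_data] of [undec_data] with the section condition unfolds to
    [dec_data]. *)
Definition dec_double : pseudo_double (dec_data pb BC Hiota) := sub_double sections_closed.

Lemma forget_strict : is_strict_double_functor dec_double S' (forget_sections pb BC Hiota).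
Proof.
split=> //.
move=> A C D A' C' D' m n m' n' c d e e'.
(* The other cases hold by computation; here only the proofs of the interface equation differ. *)
by rewrite (proof_irrelevance _ e' e).
Qed.

End Sections.

(** * The double fibration *)

Section Fibration.
Context (E B : Category) (pi : Functor E B) (pb : chosen_pullbacks B).
Context (cl : cleavage pi) (ocl : opcleavage pi) (BC : beck_chevalley cl ocl).
Context (iota : section pi) (Hiota : preserved_by_pullback cl iota).

Notation S := (dec_double pb BC Hiota).
Notation S' := (cart_span_double pb).
Notation F := (hor_functor (forget_strict pb BC Hiota)).

Lemma dec_cell_eq (m n : hcat S) (c d : Hom m n) : fun_mor F c = fun_mor F d -> c = d.
Proof. by case: c d => [c hc] [d hd] /= e; subst d; rewrite (proof_irrelevance _ hc hd). Qed.

(** The factorization [k] is given in the base; [preserves_sections_cancel] supplies its section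
    condition, and faithfulness of [F] gives uniqueness. *)
Lemma dec_cell_cartesian (m n : hcat S) (c : Hom m n) : is_cartesian F c.
Proof.
move=> p h k e.
have hk : dsec (harr p) = pull_section BC Hiota (proj2_sig k) (dsec (harr m)).
  apply/preserves_sectionsP.
  move/preserves_sectionsP: (proj2_sig h); rewrite [proj1_sig h]e => hh.
  have hc := proj1 (preserves_sectionsP BC Hiota _) (proj2_sig c).
  exact: (preserves_sections_cancel BC Hiota (proj2_sig (proj1_sig c)) hc hh).
exists (exist _ k hk); split.
- by split=> //; apply: dec_cell_eq.
- by move=> l [e' _]; apply: dec_cell_eq.
Qed.

Lemma id_cartesian (C : Category) (X Y : C) (f : Hom X Y) : is_cartesian (id_functor C) f.
Proof. by move=> Z h k e; exists k; split=> // l []. Qed.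

(** Each arrow is its own lift. Matching on the fibre equation makes the cleavage compute at
    [eq_refl], where the source and target conditions evaluate it. *)
Definition id_cleavage (C : Category) : cleavage (id_functor C) :=
  fun a b f Y =>
  match Y in fob _ _ return cart_lift f Y with
  | @Fob _ _ _ _ Y0 e =>
    match e in _ = b'
      return forall f : Hom a b', cart_lift f (@Fob _ _ (id_functor C) b' Y0 e) with
    | eq_refl => fun f =>
      MkCartLift (cl_mor:=Fhom (over_fun_mor (id_functor C) f)) (@id_cartesian C a Y0 f)
    end f
  end.

Definition cell_lift (m : hcat S') (n : hcat S) (c : Hom m (F n)) :
    cart_lift c (@Fob _ _ F _ n eq_refl).
Proof.
(* Only for [m] in constructor form is [F m'] convertible to it, as [eq_refl] in the fibre
   requires. *)
destruct m as [A C m].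
(* With the reindexed section as decoration, the condition on [c'] is [eq_refl]. *)
pose m' : hcat S := @MkHtot (dec_data pb BC Hiota) A C
  (MkDecSpan (pull_section BC Hiota (proj2_sig c) (dsec (harr n)))).
pose c' : @Hom (hcat S) m' n := exist _ c eq_refl.
exact: (MkCartLift (cl_mor:=Fhom (over_fun_mor F c')) (@dec_cell_cartesian _ _ c')).
Defined.

Definition cell_cleavage : cleavage F :=
  fun a b f Y =>
  match Y in fob _ _ return cart_lift f Y with
  | @Fob _ _ _ _ n e =>
    match e in _ = b' return forall f : Hom a b', cart_lift f (@Fob _ _ F b' n e) with
    | eq_refl => fun f => cell_lift f
    end f
  end.

End Fibration.

Theorem theorem2p15
  (E B : Category) (pi : Functor E B)
  (HB : finitely_complete B) (pb : chosen_pullbacks B)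
  (cl : cleavage pi) (ocl : opcleavage pi)
  (BC : beck_chevalley cl ocl)
  (iota : section pi) (Hiota : preserved_by_pullback cl iota) :
  exists (S : pseudo_double (dec_data pb BC Hiota))
    (HF : is_strict_double_functor S (cart_span_double pb) (forget_sections pb BC Hiota)),
    is_double_fibration HF.
Proof.
exists (dec_double pb BC Hiota), (forget_strict pb BC Hiota); split; last split.
- exists (@id_cleavage B), (@cell_cleavage _ _ _ pb _ _ BC _ Hiota).
  (* Once [m] is a constructor, both chosen lifts reduce to the same side of [c]. *)
  by split; move=> [A C m] n c.
- by move=> *; apply: dec_cell_cartesian.
- by move=> *; apply: dec_cell_cartesian.
Qed.
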